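(* If $p\in\mathbf Z^I$ and $\mathcal B_{\mathbf N,p}\neq\emptyset$, then $p\in\mathbf N^I$.
   Context: **Combinatorial data.** $I$ is a finite set and $(a_{ij})_{i,j\in I}$ is a symmetric positive definite integer matrix with $a_{ii}=2$ and $a_{ij}\in\{0,-1\}$ for $i\ne j$. $\mathbf Z[I]$ is the free abelian group with basis $\{i';i\in I\}$; $s_i:\mathbf Z[I]\to\mathbf Z[I]$ is $j'\mapsto j'-a_{ij}i'$; $W$ is the (finite Coxeter) group generated by the $s_i$, with length $w\mapsto|w|$; $w_0$ is its longest element, $\nu=|w_0|$. $\mathcal I$ is the set of sequences $\mathbf i=(i_1,\dots,i_\nu)$ in $I$ with $s_{i_1}\cdots s_{i_\nu}=w_0$. A semifield is a set $K$ with operations $+$ (commutative, associative) and $\times$ (making $K$ an abelian group), with $\times$ distributive over $+$. Elements $(\mathbf i,\mathbf a),(\mathbf i',\mathbf a')\in\mathcal I\times K^\nu$ are *adjacent* if one of the following holds: (i) for some $l\in[1,\nu-2]$, $i'_k=i_k$ and $a'_k=a_k$ for $k\notin\{l,l+1,l+2\}$, $(i_l,i_{l+1},i_{l+2})=(i,j,i)$, $(i'_l,i'_{l+1},i'_{l+2})=(j,i,j)$ with $a_{ij}=-1$, and $(a_l,a_{l+1},a_{l+2})=(a,b,c)$, $(a'_l,a'_{l+1},a'_{l+2})=(bc/(a+c),\,a+c,\,ab/(a+c))$; (ii) for some $l\in[1,\nu-1]$, $i'_k=i_k$ and $a'_k=a_k$ for $k\notin\{l,l+1\}$, $(i_l,i_{l+1})=(i,j)$,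 $(i'_l,i'_{l+1})=(j,i)$ with $a_{ij}=0$, and $a'_l=a_{l+1}$, $a'_{l+1}=a_l$. $\mathcal U_K$ is the set of classes of the equivalence relation generated by adjacency. For each $\mathbf i\in\mathcal I$ the map $K^\nu\to\mathcal U_K$, $\mathbf a\mapsto$ class of $(\mathbf i,\mathbf a)$, is a bijection. **The involution $\phi_K$.** Let $\mathbf k$ be an algebraically closed field of characteristic $0$ and $G$ a connected reductive group over $\mathbf k$ with Cartan matrix $(a_{ij})$ and a pinning: maximal torus $T$, opposite Borel subgroups $B^+,B^-$ containing $T$, and simple root homomorphisms $x_i:\mathbf k\to B^+$, $y_i:\mathbf k\to B^-$. For a semifield $K_0\subset\mathbf k^*$ (with operations induced from $\mathbf k$) and $A\in\mathcal U_{K_0}$ represented by $(\mathbf i,\mathbf a)$, put $A^+=x_{i_1}(a_1)\cdots x_{i_\nu}(a_\nu)$, $A^-=y_{i_1}(a_1)\cdots y_{i_\nu}(a_\nu)$ (independent of the representative). There is a unique bijection $\phi_{K_0}:\mathcal U_{K_0}\to\mathcal U_{K_0}$ with $(A^+)^{-1}B^-A^+=(\phi_{K_0}(A)^-)^{-1}B^+\phi_{K_0}(A)^-$. In the coordinates given by elements of $\mathcal I$ it is given by quotients of nonzero polynomials with coefficients in $\mathbf N$, independent of $K_0$; for any semifield $K$, $\phi_K:\mathcal U_K\to\mathcal U_K$ is defined by evaluating the same expressions in $K$. One has $\phi_K^2=1$. **The case $K=\mathbf Z$.** $\mathbf Z$ is the semifield in which the sum of $a,b$ is $\min(a,b)$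 and the product is the usual $a+b$. $\mathcal U_{\mathbf N}\subset\mathcal U_{\mathbf Z}$ is the set of classes of elements of $\mathcal I\times\mathbf N^\nu$ (a union of classes). For $p=(p_i)\in\mathbf Z^I$, $S_p:\mathcal U_{\mathbf Z}\to\mathcal U_{\mathbf Z}$ sends the class of $(\mathbf i,(a_k))$ to that of $(\mathbf i,(a_k+p_{i_k}))$. $\mathcal B_{\mathbf Z}=\{(A,A')\in\mathcal U_{\mathbf Z}\times\mathcal U_{\mathbf Z};\phi_{\mathbf Z}(A)=A'\}$, and $\underline S_p:\mathcal B_{\mathbf Z}\to\mathcal B_{\mathbf Z}$ is $(A,A')\mapsto(S_pA,S_{-p}A')$. $\mathcal B^+_{\mathbf N}=\{(A,A')\in\mathcal B_{\mathbf Z};A\in\mathcal U_{\mathbf N}\}$, $\mathcal B^-_{\mathbf N}=\{(A,A')\in\mathcal B_{\mathbf Z};A'\in\mathcal U_{\mathbf N}\}$, $\mathcal B_{\mathbf N,p}=\mathcal B^+_{\mathbf N}\cap\underline S_p(\mathcal B^-_{\mathbf N})$. *)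

(* Defs.v *)
From HB Require Import structures.
From mathcomp Require Import all_boot all_order all_algebra.
From mathcomp Require Import mpoly.
From Stdlib Require Import Relation_Operators.

Set Implicit Arguments.
Unset Strict Implicit.
Unset Printing Implicit Defensive.

Import Order.TTheory GRing.Theory Num.Theory.
Local Open Scope ring_scope.

Section Weyl.
Variables (I : finType) (a : I -> I -> int).

(* Positivity on the nonzero vectors of the lattice Z[I] is the same as
   positivity on the nonzero real vectors, because a is integral: the radical
   of a positive semidefinite integral form is spanned by integral vectors. *)
Definition cartan : Prop :=
  [/\ forall i j, a i j = a j i,
      forall x : {ffun I -> int}, x != 0 ->
        0 < \sum_i \sum_j x i * a i j * x j,
      forall i, a i i = 2
    & forall i j, i != j -> a i j = 0 \/ a i j = -1].

Definition basisZ (i : I) : {ffun I -> int} := [ffun j => (j == i)%:R].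

(* The linear extension of j' |-> j' - a_ij i'; see simple_refl_basis. *)
Definition simple_refl (i : I) (x : {ffun I -> int}) : {ffun I -> int} :=
  x - basisZ i *~ (\sum_j x j * a i j).

Lemma simple_refl_basis i j :
  simple_refl i (basisZ j) = basisZ j - basisZ i *~ a i j.
Proof.
rewrite /simple_refl; congr (_ - _ *~ _).
rewrite (bigD1 j) //= ffunE eqxx mul1r big1 ?addr0 // => l nlj.
by rewrite ffunE (negbTE nlj) mul0r.
Qed.

Definition word_act (s : seq I) : {ffun I -> int} -> {ffun I -> int} :=
  foldr (fun i f => simple_refl i \o f) id s.

(* w belongs to W and |w| = m; words in the s_i suffice since each s_i is an
   involution. *)
Definition has_length (w : {ffun I -> int} -> {ffun I -> int}) (m : nat) :=
  (exists2 s : seq I, size s = m & word_act s =1 w) /\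
  (forall s : seq I, word_act s =1 w -> (m <= size s)%N).

Definition longest (w0 : {ffun I -> int} -> {ffun I -> int}) (nu : nat) :=
  has_length w0 nu /\ (forall w m, has_length w m -> (m <= nu)%N).

End Weyl.

Record semifield := Semifield {
  sf_car :> Type;
  sadd : sf_car -> sf_car -> sf_car;
  smul : sf_car -> sf_car -> sf_car;
  sone : sf_car;
  sinv : sf_car -> sf_car;
  saddA : associative sadd;
  saddC : commutative sadd;
  smulA : associative smul;
  smulC : commutative smul;
  smul1 : left_id sone smul;
  smulV : left_inverse sone sinv smul;
  smulDl : left_distributive smul sadd
}.
Arguments sone {_}.

Definition sdiv (K : semifield) (x y : K) : K := smul x (sinv y).

Lemma trop_addDl :
  @left_distributive int int +%R Num.min.
Proof. by move=> x y z; rewrite addr_minl. Qed.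

Definition tropZ : semifield :=
  @Semifield int Num.min +%R 0 -%R (@minA _ _) (@minC _ _)
    (@addrA _) (@addrC _) (@add0r _) (@addNr _) trop_addDl.

(* The coefficients are in N; they are taken in int because {mpoly R[n]}
   requires R to be a ring. *)
Record nquot (n : nat) := NQuot {
  nq_num : {mpoly int[n]};
  nq_den : {mpoly int[n]};
  nq_num_neq0 : nq_num != 0;
  nq_den_neq0 : nq_den != 0;
  nq_num_ge0 : forall m, 0 <= nq_num@_m;
  nq_den_ge0 : forall m, 0 <= nq_den@_m
}.

Section Evaluation.
Variables (K : semifield) (n : nat).

(* Used only for nonempty s: a semifield has no zero. *)
Definition ssum (s : seq K) : K :=
  if s is x :: s' then foldl (@sadd K) x s' else sone.

Definition smonom (v : 'I_n -> K) (m : 'X_{1..n}) : K :=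
  \big[@smul K/sone]_(l < n) iter (m l) (smul (v l)) sone.

(* Each monomial is repeated as many times as its coefficient indicates. *)
Definition speval (v : 'I_n -> K) (P : {mpoly int[n]}) : K :=
  ssum (flatten [seq nseq `|P@_m|%N (smonom v m) | m <- msupp P]).

Definition nqeval (v : 'I_n -> K) (f : nquot n) : K :=
  sdiv (speval v (nq_num f)) (speval v (nq_den f)).

End Evaluation.

Section UK.
Variables (I : finType) (a : I -> I -> int) (nu : nat).
Variable w0 : {ffun I -> int} -> {ffun I -> int}.

Definition is_word (i : nu.-tuple I) : Prop := word_act a i =1 w0.

Section OverK.
Variable K : semifield.

Definition pt := (nu.-tuple I * nu.-tuple K)%type.

Definition agree_off (s : seq 'I_nu) (x y : pt) : Prop :=
  forall l, l \notin s ->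
    tnth y.1 l = tnth x.1 l /\ tnth y.2 l = tnth x.2 l.

Definition adj3 (x y : pt) : Prop :=
  exists (p q r : 'I_nu) (i j : I),
    [/\ q = p.+1 :> nat, r = p.+2 :> nat, a i j = -1
      & agree_off [:: p; q; r] x y] /\
    [/\ tnth x.1 p = i, tnth x.1 q = j & tnth x.1 r = i] /\
    [/\ tnth y.1 p = j, tnth y.1 q = i & tnth y.1 r = j] /\
    (let α := tnth x.2 p in let β := tnth x.2 q in let γ := tnth x.2 r in
     [/\ tnth y.2 p = sdiv (smul β γ) (sadd α γ),
         tnth y.2 q = sadd α γ
       & tnth y.2 r = sdiv (smul α β) (sadd α γ)]).

Definition adj2 (x y : pt) : Prop :=
  exists (p q : 'I_nu) (i j : I),
    [/\ q = p.+1 :> nat, a i j = 0 & agree_off [:: p; q] x y] /\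
    [/\ tnth x.1 p = i, tnth x.1 q = j, tnth y.1 p = j & tnth y.1 q = i] /\
    (tnth y.2 p = tnth x.2 q /\ tnth y.2 q = tnth x.2 p).

Definition adjacent (x y : pt) : Prop :=
  [/\ is_word x.1, is_word y.1 & adj3 x y \/ adj2 x y].

Definition pt_equiv : pt -> pt -> Prop := clos_refl_sym_trans pt adjacent.

(* A class is a subset of the set of pairs; for A : UK, the proposition A x
   says that the pair x represents A. *)
Record UK := MkUK {
  UK_mem :> pt -> Prop;
  UK_class : exists2 x : pt, is_word x.1 & forall y, UK_mem y <-> pt_equiv x y
}.

End OverK.

Local Notation ptZ := (pt tropZ).
Local Notation UZ := (UK tropZ).

Definition shift (p : I -> int) (x : ptZ) : ptZ :=
  (x.1, [tuple (tnth x.2 l : int) + p (tnth x.1 l) | l < nu]).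

Lemma tnth_shift p (x : ptZ) l :
  tnth (shift p x).2 l = (tnth x.2 l : int) + p (tnth x.1 l).
Proof. by rewrite tnth_mktuple. Qed.

Lemma shiftK p x : shift (fun i => - p i) (shift p x) = x.
Proof.
case: x => i v; congr (_, _); apply: eq_from_tnth => l.
by rewrite !tnth_mktuple /= addrK.
Qed.

Lemma shiftVK p x : shift p (shift (fun i => - p i) x) = x.
Proof.
case: x => i v; congr (_, _); apply: eq_from_tnth => l.
by rewrite !tnth_mktuple /= subrK.
Qed.

Lemma agree_off_shift p s x y :
  agree_off s x y -> agree_off s (shift p x) (shift p y).
Proof. by move=> h l ls; have [h1 h2] := h l ls; rewrite !tnth_shift h1 h2. Qed.

Lemma adjacent_shift p x y : adjacent x y -> adjacent (shift p x) (shift p y).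
Proof.
case=> wx wy h; split=> //; case: h => [h|h]; [left|right].
- case: h => u [v [r [i [j [[Ev Er aij hoff] [[x1 x2 x3] [[y1 y2 y3] hv]]]]]]].
  exists u, v, r, i, j; split; first by split=> //; apply: agree_off_shift.
  split=> //; split=> //; rewrite /= !tnth_shift x1 x2 x3 y1 y2 y3.
  case: hv => /= -> -> ->; rewrite /sdiv /= -!addr_minl.
  have E (b c m q r' : int) : b + c - m + q = b + q + (c + r') - (m + r').
    by rewrite -[RHS]addrA [m + r']addrC addrKA -addrA [- m + q]addrC addrACA.
  have E' (b c m q r' : int) : c + b - m + q = c + r' + (b + q) - (m + r').
    by rewrite [c + b]addrC [c + r' + _]addrC; apply: E.
  by split; [refine (E _ _ _ _ _)| |refine (E' _ _ _ _ _)].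
- case: h => u [v [i [j [[Ev aij hoff] [[x1 x2 y1 y2] [v1 v2]]]]]].
  exists u, v, i, j; split; first by split=> //; apply: agree_off_shift.
  by split=> //; rewrite !tnth_shift x1 x2 y1 y2 v1 v2.
Qed.

Lemma pt_equiv_shift p x y : pt_equiv x y -> pt_equiv (shift p x) (shift p y).
Proof.
elim=> [u v h|u|u v _ h|u v z _ h1 _ h2].
- exact/rst_step/adjacent_shift.
- exact: rst_refl.
- exact: rst_sym.
- exact: rst_trans h1 h2.
Qed.

Lemma S_class p (A : UZ) :
  exists2 x : ptZ, is_word x.1 &
    forall y, (exists2 z, A z & y = shift p z) <-> pt_equiv x y.
Proof.
have [x wx hx] := UK_class A; exists (shift p x) => // y; split.
  by case=> z /hx xz ->; apply: pt_equiv_shift.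
move=> h; exists (shift (fun i => - p i) y); last by rewrite shiftVK.
by apply/hx; rewrite -[x](shiftK p); apply: pt_equiv_shift.
Qed.

Definition S_shift (p : I -> int) (A : UZ) : UZ := MkUK (S_class p A).

Definition U_N (A : UZ) : Prop :=
  exists2 x, A x & forall l, 0 <= (tnth x.2 l : int).

Section Tropical.
Variable phiZ : UZ -> UZ.

Definition B_Z (x : UZ * UZ) : Prop := phiZ x.1 = x.2.

Definition Sbar (p : I -> int) (x : UZ * UZ) : UZ * UZ :=
  (S_shift p x.1, S_shift (fun i => - p i) x.2).

Definition Bplus_N (x : UZ * UZ) : Prop := B_Z x /\ U_N x.1.
Definition Bminus_N (x : UZ * UZ) : Prop := B_Z x /\ U_N x.2.

Definition B_Np (p : I -> int) (x : UZ * UZ) : Prop :=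
  Bplus_N x /\ exists2 y, Bminus_N y & x = Sbar p y.

End Tropical.

End UK.

(* Subsets of GL_n(k) are predicates on all n x n matrices. *)
Section AlgebraicGroups.
Variables (k : fieldType) (n : nat).
Implicit Types (X Y G H T B : 'M[k]_n -> Prop) (g h t : 'M[k]_n).

Definition included X Y : Prop := forall g, X g -> Y g.

Definition zclosed X : Prop :=
  exists F : {mpoly k[n * n]} -> Prop, forall g,
    X g <-> g \in unitmx /\ (forall f, F f -> f.@[mxvec g 0] = 0).

Definition subgroup H : Prop :=
  [/\ included H (fun g => g \in unitmx), H 1%:M,
      forall g h, H g -> H h -> H (g *m h)
    & forall g, H g -> H (invmx g)].

Definition alg_group H : Prop := zclosed H /\ subgroup H.

Definition connected X : Prop :=
  forall Y Z, zclosed Y -> zclosed Z ->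
    (forall g, X g <-> Y g \/ Z g) -> (forall g, ~ (Y g /\ Z g)) ->
    (forall g, ~ Y g) \/ (forall g, ~ Z g).

Definition derived H : 'M[k]_n -> Prop := fun g =>
  forall H', subgroup H' ->
    (forall x y, H x -> H y -> H' (x *m y *m invmx x *m invmx y)) -> H' g.

Definition solvable H : Prop :=
  exists m, forall g, iter m derived H g -> g = 1%:M.

Definition unipotent g : Prop := exists m, (g - 1%:M) ^+ m = 0.

(* The unipotent radical of G is trivial. *)
Definition reductive G : Prop :=
  forall U, alg_group U -> connected U -> included U G ->
    (forall g u, G g -> U u -> U (g *m u *m invmx g)) ->
    (forall u, U u -> unipotent u) -> forall u, U u -> u = 1%:M.

Definition torus T : Prop :=
  [/\ alg_group T, connected T &
      exists2 P, P \in unitmx &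
        forall t, T t -> is_diag_mx (P *m t *m invmx P)].

Definition maximal_torus G T : Prop :=
  [/\ torus T, included T G &
      forall T', torus T' -> included T' G -> included T T' -> included T' T].

Definition connected_solvable B : Prop :=
  [/\ alg_group B, connected B & solvable B].

Definition borel G B : Prop :=
  [/\ connected_solvable B, included B G &
      forall B', connected_solvable B' -> included B' G -> included B B' ->
        included B' B].

(* Restrictions to X of the functions in k[GL_n] = k[x_ij, 1/det]. *)
Definition regular_on X (f : 'M[k]_n -> k) : Prop :=
  exists (P : {mpoly k[n * n]}) (m : nat),
    forall g, X g -> f g = P.@[mxvec g 0] / (\det g) ^+ m.

(* Characters of T are represented by functions on all matrices; only their
   values on T matter. *)
Definition is_character T (χ : 'M[k]_n -> k) : Prop :=
  [/\ forall t, T t -> χ t != 0,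
      forall s t, T s -> T t -> χ (s *m t) = χ s * χ t
    & regular_on T χ].

(* The tangent space at 1; since det is a unit at 1, the polynomials vanishing
   on H give the same space as the whole ideal of H in k[x_ij, 1/det]. *)
Definition lie H (x : 'M[k]_n) : Prop :=
  forall f : {mpoly k[n * n]}, (forall h, H h -> f.@[mxvec h 0] = 0) ->
    \sum_(l < n * n) mxvec x 0 l * (f^`M(l)).@[mxvec (1%:M : 'M[k]_n) 0] = 0.

(* The nontrivial weights of T in the adjoint action on Lie H. *)
Definition is_root T H (γ : 'M[k]_n -> k) : Prop :=
  [/\ is_character T γ, exists2 t, T t & γ t != 1 &
      exists x, [/\ x != 0, lie H x &
        forall t, T t -> t *m x *m invmx t = γ t *: x]].

(* (α_i) is the base of the root system of (G, T) whose positive roots are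
   the roots of B. *)
Definition is_base (I : finType) G T B (α : I -> 'M[k]_n -> k) : Prop :=
  [/\ forall i, is_root T B (α i),
      forall m : I -> int,
        (forall t, T t -> \prod_i α i t ^ m i = 1) -> forall i, m i = 0
    & forall γ, is_root T G γ ->
        (is_root T B γ /\ exists m : I -> nat,
           forall t, T t -> γ t = \prod_i α i t ^+ m i) \/
        (~ is_root T B γ /\ exists m : I -> nat,
           forall t, T t -> γ t = (\prod_i α i t ^+ m i)^-1)].

(* u : k -> B is an injective morphism of algebraic groups normalized by T
   through γ. *)
Definition root_hom T B (γ : 'M[k]_n -> k) (u : k -> 'M[k]_n) : Prop :=
  [/\ exists M : 'M[{poly k}]_n, forall c i j, u c i j = (M i j).[c],
      injective u,
      forall c d, u (c + d) = u c *m u d,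
      forall c, B (u c)
    & forall t c, T t -> t *m u c *m invmx t = u (γ t * c)].

End AlgebraicGroups.

Definition mx2 (k : fieldType) (a b c d : k) : 'M[k]_(1 + 1) :=
  block_mx a%:M b%:M c%:M d%:M.

Definition sl2_hom (k : fieldType) (n : nat) (G : 'M[k]_n -> Prop)
    (ψ : 'M[k]_(1 + 1) -> 'M[k]_n) : Prop :=
  let SL2 := fun g : 'M[k]_(1 + 1) => \det g = 1 in
  [/\ forall g, SL2 g -> G (ψ g),
      forall g h, SL2 g -> SL2 h -> ψ (g *m h) = ψ g *m ψ h
    & forall i j, regular_on SL2 (fun g => ψ g i j)].

(* A connected reductive group over k with Cartan matrix a and a pinning; the
   i-th simple coroot is t |-> pg_sl2 i (mx2 t 0 0 t^-1). *)
Record pinned_group (k : fieldType) (I : finType) (a : I -> I -> int) :=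
  PinnedGroup {
  pg_dim : nat;
  pg_G : 'M[k]_pg_dim -> Prop;
  pg_T : 'M[k]_pg_dim -> Prop;
  pg_Bp : 'M[k]_pg_dim -> Prop;
  pg_Bm : 'M[k]_pg_dim -> Prop;
  pg_root : I -> 'M[k]_pg_dim -> k;
  pg_sl2 : I -> 'M[k]_(1 + 1) -> 'M[k]_pg_dim;
  pg_x : I -> k -> 'M[k]_pg_dim;
  pg_y : I -> k -> 'M[k]_pg_dim;
  pg_alg : alg_group pg_G;
  pg_connected : connected pg_G;
  pg_reductive : reductive pg_G;
  pg_torus : maximal_torus pg_G pg_T;
  pg_borelp : borel pg_G pg_Bp;
  pg_borelm : borel pg_G pg_Bm;
  pg_opposite : forall g, pg_T g <-> pg_Bp g /\ pg_Bm g;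
  pg_base : is_base pg_G pg_T pg_Bp pg_root;
  pg_xroot : forall i, root_hom pg_T pg_Bp (pg_root i) (pg_x i);
  pg_yroot : forall i,
    root_hom pg_T pg_Bm (fun t => (pg_root i t)^-1) (pg_y i);
  pg_sl2_hom : forall i, sl2_hom pg_G (pg_sl2 i);
  pg_sl2x : forall i c, pg_sl2 i (mx2 1 c 0 1) = pg_x i c;
  pg_sl2y : forall i c, pg_sl2 i (mx2 1 0 c 1) = pg_y i c;
  pg_sl2T : forall i t, t != 0 -> pg_T (pg_sl2 i (mx2 t 0 0 t^-1));
  pg_cartan : forall i j t, t != 0 ->
    pg_root j (pg_sl2 i (mx2 t 0 0 t^-1)) = t ^ a i j
}.

(* ι identifies the semifield K0 with a subset of k^*, with the operations
   induced from k. *)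
Definition sf_embedding (k : fieldType) (K0 : semifield) (ι : K0 -> k) :=
  [/\ injective ι, forall x, ι x != 0,
      forall x y, ι (sadd x y) = ι x + ι y
    & forall x y, ι (smul x y) = ι x * ι y].

Section Phi.
Variables (I : finType) (a : I -> I -> int) (nu : nat).
Variable w0 : {ffun I -> int} -> {ffun I -> int}.
Variables (k : fieldType) (P : pinned_group k a).

Local Notation U := (UK a nu w0).

Section Embedded.
Variables (K0 : semifield) (ι : K0 -> k).

(* z_{i_1}(a_1) ... z_{i_nu}(a_nu), for z = x or z = y *)
Definition pt_prod (z : I -> k -> 'M[k]_(pg_dim P)) (x : pt I nu K0) :=
  \big[mulmx/1%:M]_(l < nu) z (tnth x.1 l) (ι (tnth x.2 l)).

(* g^-1 B g *)
Definition conj_set (B : 'M[k]_(pg_dim P) -> Prop) (g : 'M[k]_(pg_dim P)) :=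
  fun h => B (g *m h *m invmx g).

Definition is_phi0 (phi0 : U K0 -> U K0) : Prop :=
  bijective phi0 /\
  forall (A : U K0) x y, A x -> phi0 A y ->
    forall h, conj_set (@pg_Bm _ _ _ P) (pt_prod (@pg_x _ _ _ P) x) h <->
              conj_set (@pg_Bp _ _ _ P) (pt_prod (@pg_y _ _ _ P) y) h.

End Embedded.

(* E i i' is an expression in terms of quotients of polynomials: coordinates
   along i on the source, along i' on the target. *)
Definition coord_expr := nu.-tuple I -> nu.-tuple I -> 'I_nu -> nquot nu.

Definition given_by (K : semifield) (E : coord_expr) (phi : U K -> U K) :=
  forall i i' v (A : U K),
    is_word a w0 i -> is_word a w0 i' -> A (i, v) ->
    phi A (i', [tuple nqeval (tnth v) (E i i' l) | l < nu]).

(* phi is obtained by evaluating in K expressions which give phi_{K0} for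
   all the semifields K0 contained in k^*. *)
Definition is_phi (K : semifield) (phi : U K -> U K) : Prop :=
  exists2 E : coord_expr,
    (forall (K0 : semifield) (ι : K0 -> k), sf_embedding ι ->
       exists2 phi0 : U K0 -> U K0, is_phi0 ι phi0 & given_by E phi0)
    & given_by E phi.

End Phi.

(* Main.v *)
Require Import Defs.
From HB Require Import structures.
From mathcomp Require Import all_boot all_order all_algebra.
From mathcomp Require Import mpoly zify ring.
From Stdlib Require Import Relation_Operators Operators_Properties Classical.

Set Implicit Arguments.
Unset Strict Implicit.
Unset Printing Implicit Defensive.

Import Order.TTheory GRing.Theory Num.Theory.
Local Open Scope ring_scope.

(** Let [A] contain the class of a word [w] of the longest element with
    coordinates [m >= 0], and let [A'] be its image, with coordinates [e] along
    the same word. The two conditions defining the set in question say that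
    [m >= 0] and [e o + p (w o) >= 0] for all [o]. For a letter [i], the word
    can be chosen to end in [i]: reduced words of the same element are linked by
    braid moves ([reduced_braids]), and these preserve nonnegativity
    ([nonneg_representative]). The bound on [p i] then comes from one identity,
    valid over every semifield contained in the field: if [a] and [b] are the
    coordinates of a point and of its image, then
      the last [a o], times the sum of the [b o] with [w o = i], equals [1]
    ([opposite_flags], [inverse_coordinate]). Take [a o = N ^ (- m o)] in the
    semifield of positive rationals. Each coordinate [b o] is at most a constant
    times [N ^ (- e o)], hence times [N ^ p i] when [w o = i], and the last
    [a o] is at most [1]; so [1] is at most a constant times [N ^ p i] for every
    positive integer [N], which forces [p i >= 0].

    In a highest weight representation, the identity compares two descriptions of
    the line fixed by the common Borel subgroup, through the coefficients of the
    highest weight vector and of its image under [f_i]. The proof below stays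
    inside the Lie algebra. Write the point as [u = u' x_i(t)], where [u'] has one factor less, let [v] be the product of
    the [y_j] for its image and let [c] be the sum of the coordinates of [v]
    along [i]. If [t c != 1], a factorization in [SL_2] shows that
    [u'^-1 Bm u'] is the conjugate of [Bp] by a lower triangular element. On the
    other hand [Ad (x_j a)] sends the negative Borel subalgebra into its sum
    with the line of [e_j] ([Ad_x_bminus]), so each factor of [u'] costs at most
    one dimension ([elimination]), and the negative nilpotent algebra contains
    one independent root vector for each letter of the reduced word
    ([root_vectors]), that is, one more than the number of factors of [u'].
    Hence some nonzero [Y] in the nilpotent algebra is sent by [Ad u'] to a
    vector tangent to [Bm]. Transported to [Bp], it stays strictly lower
    triangular, whereas all the weights on the Lie algebra of [Bp] are trivial
    or products of simple roots ([low_tangent_Bp]): a contradiction.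

    The facts about the group which this uses are that [x_i] and [y_j] commute
    for [i != j] ([x_y_comm]) and how the [x_i], [y_i] and coroots act on each
    other's velocities. They follow by differentiating rational curves, since
    every velocity of a curve in a group lies in its Lie algebra
    ([tangent_lie]), whose weights are restricted by the base of roots. *)

(** * Generic points of the affine line *)

Section Jets.
Variable F : fieldType.
Hypothesis hF : [pchar F] =i pred0.
Implicit Types (p q d : {poly F}) (γ : F -> F) (a b c : F) (P Q : F -> Prop).

Lemma natf_inj : injective (fun m : nat => m%:R : F).
Proof.
have h := (pcharf0P F).1 hF.
have le m n : (m <= n)%N -> m%:R = n%:R :> F -> m = n.
  move=> mn /eqP; rewrite eq_sym -subr_eq0 -natrB // h subn_eq0 => nm.
  by apply/eqP; rewrite eqn_leq mn.
by move=> m n /= e; case: (leqP m n) => [/le->//|/ltnW/le/(_ (esym e))].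
Qed.

Definition generic P := exists2 q, q != 0 & forall c, q.[c] != 0 -> P c.

Lemma generic_all P : (forall c, P c) -> generic P.
Proof. by exists 1 => //; apply: oner_neq0. Qed.

Lemma genericS P Q : (forall c, P c -> Q c) -> generic P -> generic Q.
Proof. by move=> h [q q0 hq]; exists q => // c /hq /h. Qed.

Lemma genericI P Q : generic P -> generic Q -> generic (fun c => P c /\ Q c).
Proof.
move=> [q q0 hq] [r r0 hr]; exists (q * r); first by rewrite mulf_neq0.
by move=> c; rewrite hornerM mulf_eq0 negb_or => /andP[/hq ? /hr ?].
Qed.

Lemma generic_neq0 p : p != 0 -> generic (fun c => p.[c] != 0).
Proof. by exists p. Qed.

Lemma generic_points P n : generic P ->
  exists s : seq F, [/\ uniq s, size s = n & {in s, forall c, P c}].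
Proof.
(* Among [n + size q] distinct integers, fewer than [size q] are roots of [q]. *)
case=> q q0 hq; pose s0 := [seq (i%:R : F) | i <- iota 0 (n + size q)].
have u0 : uniq s0 by rewrite map_inj_uniq ?iota_uniq //; apply: natf_inj.
have h : (n <= size (filter (predC (root q)) s0))%N.
  rewrite size_filter -(leq_add2l (count (root q) s0)) count_predC size_map size_iota.
  rewrite addnC leq_add2l ltnW // -size_filter; apply: max_poly_roots => //.
    by apply: filter_all.
  by rewrite filter_uniq.
exists (take n (filter (predC (root q)) s0)); split.
- by rewrite take_uniq // filter_uniq.
- by rewrite size_takel.
- by move=> c /mem_take; rewrite mem_filter => /andP[/hq].
Qed.

Lemma generic_poly0 p : generic (fun c => p.[c] = 0) -> p = 0.
Proof.
case/(generic_points (size p)) => s [us ss hs].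
apply: (@roots_geq_poly_eq0 _ p s) => //; last by rewrite ss.
by apply/allP => c /hs/eqP.
Qed.

(** * Jets of rational functions *)

(** [jet γ a b]: outside finitely many points, [γ] is a rational function which
    is regular at [0], with value [a] and derivative [b] there. *)
Definition jet γ a b := exists p d,
  [/\ d.[0] = 1, p.[0] = a, p^`().[0] = b + a * d^`().[0]
    & generic (fun c => γ c * d.[c] = p.[c])].

Lemma jet_unique γ γ' a b a' b' : generic (fun c => γ c = γ' c) ->
  jet γ a b -> jet γ' a' b' -> a = a' /\ b = b'.
Proof.
move=> e [p [d [d1 pa pb h]]] [p' [d' [d1' pa' pb' h']]].
have E : p * d' = p' * d.
  apply/eqP; rewrite -subr_eq0; apply/eqP/generic_poly0.
  apply: genericS (genericI e (genericI h h')) => c [ec [hc hc']].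
  by rewrite !(hornerD, hornerM, hornerN) -hc -hc' ec; ring.
have := congr1 (fun q => q.[0]) E; rewrite !hornerM d1 d1' pa pa' !mulr1 => ea.
have := congr1 (fun q => q^`().[0]) E.
rewrite !derivM !hornerE d1 d1' pa pa' pb pb' ea => eb; split=> //.
have -> : b = b + a' * d^`().[0] + a' * d'^`().[0] - a' * d^`().[0] - a' * d'^`().[0].
  by ring.
by move: eb; rewrite !mulr1 => ->; ring.
Qed.

Lemma jet_eq γ γ' a b : generic (fun c => γ c = γ' c) -> jet γ a b -> jet γ' a b.
Proof.
move=> e [p [d [d1 pa pb h]]]; exists p, d; split=> //.
by apply: genericS (genericI e h) => c [-> ->].
Qed.

Lemma jet_horner p : jet (horner p) p.[0] p^`().[0].
Proof.
exists p, 1%:P; split; rewrite ?derivC ?hornerE // ?mulr0 ?addr0 //.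
by apply: generic_all => c; rewrite hornerE mulr1.
Qed.

Lemma jet_cst c : jet (fun=> c) c 0.
Proof.
have := jet_horner c%:P; rewrite derivC !hornerE; apply: jet_eq.
by apply: generic_all => x; rewrite hornerC.
Qed.

Lemma jet_id : jet id 0 1.
Proof.
have := jet_horner 'X; rewrite derivX !hornerE; apply: jet_eq.
by apply: generic_all => x; rewrite hornerX.
Qed.

Lemma jetD γ γ' a b a' b' :
  jet γ a b -> jet γ' a' b' -> jet (fun c => γ c + γ' c) (a + a') (b + b').
Proof.
move=> [p [d [d1 pa pb h]]] [p' [d' [d1' pa' pb' h']]].
exists (p * d' + p' * d), (d * d'); split; rewrite ?(derivD, derivM) ?(hornerD, hornerM).
- by rewrite d1 d1' mulr1.
- by rewrite d1 d1' pa pa' !mulr1.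
- by rewrite pa pa' pb pb' d1 d1'; ring.
- apply: genericS (genericI h h') => c [hc hc'].
  by rewrite !(hornerD, hornerM, hornerN) -hc -hc'; ring.
Qed.

Lemma jetM γ γ' a b a' b' :
  jet γ a b -> jet γ' a' b' -> jet (fun c => γ c * γ' c) (a * a') (b * a' + a * b').
Proof.
move=> [p [d [d1 pa pb h]]] [p' [d' [d1' pa' pb' h']]].
exists (p * p'), (d * d'); split; rewrite ?(derivD, derivM) ?(hornerD, hornerM).
- by rewrite d1 d1' mulr1.
- by rewrite pa pa'.
- by rewrite pa pa' pb pb' d1 d1'; ring.
- apply: genericS (genericI h h') => c [hc hc'].
  by rewrite !(hornerD, hornerM, hornerN) -hc -hc'; ring.
Qed.

Lemma jetZ γ a b c : jet γ a b -> jet (fun x => c * γ x) (c * a) (c * b).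
Proof.
move=> h; have := jetM (jet_cst c) h; rewrite mul0r add0r; apply: jet_eq.
exact: generic_all.
Qed.

Lemma jetN γ a b : jet γ a b -> jet (fun x => - γ x) (- a) (- b).
Proof.
move=> h; have := jetZ (-1) h; rewrite !mulN1r; apply: jet_eq.
by apply: generic_all => x; rewrite mulN1r.
Qed.

Lemma jet_neq0 γ a b : a != 0 -> jet γ a b -> generic (fun c => γ c != 0).
Proof.
move=> a0 [p [d [_ pa _ h]]].
have p0 : p != 0 by apply: contraNneq a0 => p0; rewrite -pa p0 horner0.
apply: genericS (genericI h (generic_neq0 p0)) => c [hc pc].
by apply: contraNneq pc => g0; rewrite -hc g0 mul0r.
Qed.

Lemma jetV γ a b : a != 0 -> jet γ a b -> jet (fun c => (γ c)^-1) a^-1 (- b / a ^+ 2).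
Proof.
move=> a0 j; have g0 := jet_neq0 a0 j; case: j => [p [d [d1 pa pb h]]].
exists (a^-1 *: d), (a^-1 *: p); split; rewrite ?derivZ ?hornerZ.
- by rewrite pa mulVf.
- by rewrite d1 mulr1.
- by rewrite pb; field.
- apply: genericS (genericI h g0) => c [hc gc].
  by rewrite !hornerZ -hc mulrCA mulKf.
Qed.

Lemma jet_sum (I : Type) (r : seq I) (Γ : I -> F -> F) A B :
  (forall i, jet (Γ i) (A i) (B i)) ->
  jet (fun c => \sum_(i <- r) Γ i c) (\sum_(i <- r) A i) (\sum_(i <- r) B i).
Proof.
move=> h; elim: r => [|i r IH].
  by rewrite !big_nil; apply: jet_eq (jet_cst 0); apply: generic_all => c; rewrite big_nil.
rewrite !big_cons; apply: jet_eq (jetD (h i) IH).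
by apply: generic_all => c; rewrite big_cons.
Qed.

Lemma jet_comp_horner p γ a b : jet γ a b ->
  jet (fun c => p.[γ c]) p.[a] (b * p^`().[a]).
Proof.
move=> h; elim/poly_ind: p => [|p c IH].
  rewrite deriv0 !horner0 mulr0; apply: jet_eq (jet_cst 0).
  by apply: generic_all => c; rewrite horner0.
rewrite derivD derivM derivX derivC addr0 mulr1.
have := jetD (jetM IH h) (jet_cst c); rewrite !(hornerD, hornerM, hornerX, hornerC).
have -> : b * p^`().[a] * a + p.[a] * b + 0 = b * (p^`().[a] * a + p.[a]) by ring.
by apply: jet_eq; apply: generic_all => x; rewrite !hornerE.
Qed.

Lemma jet_meval n (f : {mpoly F[n]}) (Γ : F -> 'I_n -> F) (v w : 'I_n -> F) :
  (forall l, jet (Γ^~ l) (v l) (w l)) ->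
  jet (fun c => f.@[Γ c]) f.@[v] (\sum_l w l * (f^`M(l)).@[v]).
Proof.
move=> h; pose S f := jet (fun c => f.@[Γ c]) f.@[v] (\sum_l w l * (f^`M(l)).@[v]).
have SC c : S c%:MP.
  rewrite /S mevalC big1 => [|l _]; last by rewrite mderivC meval0 mulr0.
  by apply: jet_eq (jet_cst c); apply: generic_all => x; rewrite mevalC.
have SD (p q : {mpoly F[n]}) : S p -> S q -> S (p + q).
  move=> hp hq; rewrite /S mevalD.
  have -> : \sum_l w l * (p + q)^`M(l).@[v]
    = \sum_l w l * p^`M(l).@[v] + \sum_l w l * q^`M(l).@[v].
    by rewrite -big_split; apply: eq_bigr => l _; rewrite mderivD mevalD mulrDr.
  by apply: jet_eq (jetD hp hq); apply: generic_all => x; rewrite mevalD.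
have SM (p q : {mpoly F[n]}) : S p -> S q -> S (p * q).
  move=> hp hq; rewrite /S mevalM.
  have -> : \sum_l w l * (p * q)^`M(l).@[v]
    = (\sum_l w l * p^`M(l).@[v]) * q.@[v] + p.@[v] * (\sum_l w l * q^`M(l).@[v]).
    rewrite mulr_suml mulr_sumr -big_split; apply: eq_bigr => l _ /=.
    by rewrite mderivM mevalD !mevalM; ring.
  by apply: jet_eq (jetM hp hq); apply: generic_all => x; rewrite mevalM.
have SX i : S 'X_i.
  rewrite /S mevalXU (bigD1 i) //= big1 => [|l li].
    have Um : (U_(i) - U_(i))%MM = 0%MM.
      by apply/mnmP => j; rewrite mnmBE subnn mnm0E.
    rewrite mderivX mnm1E eqxx scale1r Um mpolyX0 meval1 mulr1 addr0.
    by apply: jet_eq (h i); apply: generic_all => x; rewrite mevalXU.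
  by rewrite mderivX mnm1E eq_sym (negbTE li) scale0r meval0 mulr0.
have SXn i m : S ('X_i ^+ m).
  by elim: m => [|m IH]; rewrite ?expr0 ?exprS; [apply: SC|apply: SM].
rewrite -/(S f); elim/mpolyind: f => [|c m p _ _ hp]; first by have := SC 0; rewrite mpolyC0.
apply: SD => //; rewrite -mul_mpolyC; apply: (SM); first exact: SC.
rewrite mpolyXE_id; apply: big_ind => [|u v'|i _]; last exact: SXn.
  by have := SC 1; rewrite mpolyC1.
exact: SM.
Qed.

Section MatrixJets.
Variables m n r : nat.

Definition mjet m n (Γ : F -> 'M[F]_(m, n)) (A B : 'M[F]_(m, n)) :=
  forall i j, jet (fun c => Γ c i j) (A i j) (B i j).

Lemma mjet_unique (Γ Γ' : F -> 'M[F]_(m, n)) A B A' B' :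
  generic (fun c => Γ c = Γ' c) -> mjet Γ A B -> mjet Γ' A' B' -> B = B'.
Proof.
move=> e h h'; apply/matrixP => i j.
by case: (jet_unique _ (h i j) (h' i j)) => //; apply: genericS e => c ->.
Qed.

Lemma mjet_eq (Γ Γ' : F -> 'M[F]_(m, n)) A B :
  generic (fun c => Γ c = Γ' c) -> mjet Γ A B -> mjet Γ' A B.
Proof. by move=> e h i j; apply: jet_eq (h i j); apply: genericS e => c ->. Qed.

Lemma mjet_cst (A : 'M[F]_(m, n)) : mjet (fun=> A) A 0.
Proof. by move=> i j; rewrite mxE; apply: jet_cst. Qed.

Lemma mjetM (Γ : F -> 'M[F]_(m, n)) (Γ' : F -> 'M[F]_(n, r)) A B A' B' :
  mjet Γ A B -> mjet Γ' A' B' ->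
  mjet (fun c => Γ c *m Γ' c) (A *m A') (B *m A' + A *m B').
Proof.
move=> h h' i j; rewrite !mxE -big_split /=.
have := jet_sum (index_enum 'I_n) (fun l => jetM (h i l) (h' l j)).
by apply: jet_eq; apply: generic_all => c; rewrite !mxE.
Qed.

End MatrixJets.

(** * Subspaces and polynomial curves *)

Section Subspaces.
Variables m n : nat.
Implicit Types (S : 'M[F]_(m, n) -> Prop) (Z : 'M[{poly F}]_(m, n)).

Definition subspace S := S 0 /\ forall c X Y, S X -> S Y -> S (c *: X + Y).

Definition mxeval Z c : 'M[F]_(m, n) := \matrix_(i, j) (Z i j).[c].
Definition mxcoef Z l : 'M[F]_(m, n) := \matrix_(i, j) (Z i j)`_l.

Lemma subspaceZ S c X : subspace S -> S X -> S (c *: X).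
Proof. by move=> [S0 SL] h; rewrite -[c *: X]addr0; apply: SL. Qed.

Lemma subspaceD S X Y : subspace S -> S X -> S Y -> S (X + Y).
Proof. by move=> [S0 SL] h h'; rewrite -[X]scale1r; apply: SL. Qed.

Lemma subspaceB S X Y : subspace S -> S X -> S Y -> S (X - Y).
Proof. by move=> hS h h'; rewrite -scaleN1r; apply: subspaceD => //; apply: subspaceZ. Qed.

Lemma subspace_sum S (I : Type) (r : seq I) (f : I -> 'M[F]_(m, n)) :
  subspace S -> (forall i, S (f i)) -> S (\sum_(i <- r) f i).
Proof.
move=> hS h; elim/big_rec: _ => [|i X _ hX]; first by case: hS.
exact: subspaceD.
Qed.

(** A Vandermonde system expresses the coefficients of a polynomial curve
    through finitely many of its points. *)
Lemma subspace_coef S Z l : subspace S -> generic (fun c => S (mxeval Z c)) ->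
  S (mxcoef Z l).
Proof.
move=> hS gen; pose N := (l.+1 + \max_i \max_j size (Z i j))%N.
have [s [us ss hs]] := generic_points N gen.
pose a : 'rV[F]_N := \row_i s`_i.
have Va : Vandermonde N a \in unitmx.
  rewrite unitmxE unitfE det_Vandermonde; apply/prodf_neq0 => i _.
  apply/prodf_neq0 => j ij; rewrite !mxE subr_eq0 nth_uniq ?ss //.
  by rewrite gtn_eqF.
have lN : (l < N)%N by rewrite ltn_addr.
pose W := invmx (Vandermonde N a).
have -> : mxcoef Z l = \sum_i W i (Ordinal lN) *: mxeval Z s`_i.
  apply/matrixP => i j; rewrite summxE mxE.
  have sZ : (size (Z i j) <= N)%N.
    apply: leq_trans (leq_addl _ _); apply: leq_trans (leq_bigmax i).
    exact: (leq_bigmax j).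
  pose v : 'rV[F]_N := \row_x (Z i j)`_x.
  have -> : (Z i j)`_l = (v *m Vandermonde N a *m W) 0 (Ordinal lN).
    by rewrite -mulmxA mulmxV // mulmx1 mxE.
  rewrite mxE; apply: eq_bigr => u _; rewrite !mxE mulrC; congr (_ * _).
  rewrite (horner_coef_wide _ sZ); apply: eq_bigr => x _; by rewrite !mxE.
apply: subspace_sum => // i; apply: subspaceZ => //; apply: hs.
by rewrite mem_nth // ss.
Qed.

Lemma mxeval_coef Z c : exists N, mxeval Z c = \sum_(l < N) c ^+ l *: mxcoef Z l.
Proof.
exists (\max_i \max_j size (Z i j)); apply/matrixP => i j; rewrite summxE mxE.
have sZ : (size (Z i j) <= \max_i \max_j size (Z i j))%N.
  by apply: leq_trans (leq_bigmax i); apply: (leq_bigmax j).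
by rewrite (horner_coef_wide _ sZ); apply: eq_bigr => x _; rewrite !mxE mulrC.
Qed.

(** Subspaces are closed along polynomial curves. *)
Lemma subspace_value S Z c : subspace S -> generic (fun c => S (mxeval Z c)) ->
  S (mxeval Z c).
Proof.
move=> hS gen; have [N ->] := mxeval_coef Z c; apply: subspace_sum => // l.
by apply: subspaceZ => //; apply: subspace_coef.
Qed.

Inductive span (E : 'M[F]_(m, n) -> Prop) : 'M[F]_(m, n) -> Prop :=
| span0 : span E 0
| span_cons c X Y : E X -> span E Y -> span E (c *: X + Y).

Lemma span_subspace E : subspace (span E).
Proof.
split=> [|c X Y hX hY]; first exact: span0.
elim: hX c => [|d X' Y' hX' _ IH] c; first by rewrite scaler0 add0r.
rewrite scalerDr scalerA -addrA; apply: span_cons => //; exact: IH.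
Qed.

Lemma span_in E X : E X -> span E X.
Proof. by move=> h; rewrite -[X]addr0 -[X]scale1r; apply: span_cons => //; apply: span0. Qed.

Lemma span_split E e X : span (fun Y => E Y \/ Y = e) X ->
  exists Y c, span E Y /\ X = Y + c *: e.
Proof.
elim=> [|c X' _ h _ [Y [d [hY ->]]]].
  by exists 0, 0; split; [apply: span0|rewrite scale0r addr0].
case: h => [h|->]; last by exists Y, (d + c); split=> //; rewrite scalerDl addrC addrA.
by exists (c *: X' + Y), d; split; [apply: span_cons|rewrite addrA].
Qed.

End Subspaces.

Section PolynomialCurves.
Variables m n r : nat.

Definition mxconst (A : 'M[F]_(m, n)) : 'M[{poly F}]_(m, n) := map_mx polyC A.

Lemma mxeval_const A c : mxeval (mxconst A) c = A.
Proof. by apply/matrixP => i j; rewrite !mxE hornerC. Qed.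

Lemma mxeval_inj (Z Z' : 'M[{poly F}]_(m, n)) : (forall c, mxeval Z c = mxeval Z' c) -> Z = Z'.
Proof.
move=> h; apply/matrixP => i j; apply/eqP; rewrite -subr_eq0; apply/eqP.
apply: generic_poly0; apply: generic_all => c; rewrite hornerD hornerN.
by have /matrixP/(_ i j) := h c; rewrite !mxE => ->; rewrite subrr.
Qed.

Lemma mxevalM (Z : 'M[{poly F}]_(m, n)) (Z' : 'M[{poly F}]_(n, r)) c :
  mxeval (Z *m Z') c = mxeval Z c *m mxeval Z' c.
Proof.
apply/matrixP => i j; rewrite !mxE horner_sum; apply: eq_bigr => l _.
by rewrite hornerM !mxE.
Qed.

Definition mxscale (b : F) (Z : 'M[{poly F}]_(m, n)) : 'M[{poly F}]_(m, n) :=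
  \matrix_(i, j) \poly_(l < size (Z i j)) (b ^+ l * (Z i j)`_l).

Lemma mxeval_scale b Z c : mxeval (mxscale b Z) c = mxeval Z (b * c).
Proof.
apply/matrixP => i j; rewrite !mxE horner_poly horner_coef.
by apply: eq_bigr => l _; rewrite exprMn [b ^+ l * (_)`_l]mulrC -mulrA.
Qed.

Lemma mxcoef_scale b Z l : mxcoef (mxscale b Z) l = b ^+ l *: mxcoef Z l.
Proof.
apply/matrixP => i j; rewrite !mxE coef_poly; case: ltnP => // h.
by rewrite nth_default // mulr0.
Qed.

Lemma mxeval_coef0 (Z : 'M[{poly F}]_(m, n)) c :
  (forall l, mxcoef Z l.+1 = 0) -> mxeval Z c = mxeval Z 0.
Proof.
move=> h; apply/matrixP => i j; rewrite !mxE.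
suff -> : Z i j = ((Z i j)`_0)%:P by rewrite !hornerC.
apply/polyP => -[|l]; rewrite coefC //=.
by have /matrixP/(_ i j) := h l; rewrite !mxE.
Qed.

(** In characteristic [0] a polynomial curve whose velocity vanishes
    everywhere is constant. *)
Lemma curve_constant (Z : 'M[{poly F}]_(m, n)) c :
  (forall d : F, mjet (fun b => mxeval Z (d + b)) (mxeval Z d) 0) -> mxeval Z c = mxeval Z 0.
Proof.
move=> h; apply: mxeval_coef0 => l; apply/matrixP => i j; rewrite !mxE.
have p0 : (Z i j)^`() = 0.
  apply: generic_poly0; apply: generic_all => d.
  have js : jet (fun b => d + b) d 1.
    by have := jetD (jet_cst d) jet_id; rewrite addr0 add0r.
  have [] := jet_unique _ (h d i j) (jet_comp_horner (Z i j) js).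
    by apply: generic_all => b; rewrite mxE.
  by rewrite !mxE mul1r.
have := congr1 (fun q : {poly F} => q`_l) p0; rewrite coef_deriv coef0 -mulr_natr.
by move/eqP; rewrite mulf_eq0 ((pcharf0P F).1 hF) orbF => /eqP.
Qed.

End PolynomialCurves.

Lemma mxcoef_constM m n r (A : 'M[F]_(m, n)) (Z : 'M[{poly F}]_(n, r)) l :
  mxcoef (mxconst A *m Z) l = A *m mxcoef Z l.
Proof.
apply/matrixP => i j; rewrite !mxE coef_sum; apply: eq_bigr => u _.
by rewrite !mxE coefCM.
Qed.

Lemma mxcoefMconst m n r (Z : 'M[{poly F}]_(m, n)) (A : 'M[F]_(n, r)) l :
  mxcoef (Z *m mxconst A) l = mxcoef Z l *m A.
Proof.
apply/matrixP => i j; rewrite !mxE coef_sum; apply: eq_bigr => u _.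
by rewrite !mxE coefMC.
Qed.

Lemma span_map m n m' n' (E : 'M[F]_(m, n) -> Prop) (S : 'M[F]_(m', n') -> Prop)
    (f : 'M[F]_(m, n) -> 'M[F]_(m', n')) X :
  subspace S -> linear f -> (forall Y, E Y -> S (f Y)) -> span E X -> S (f X).
Proof.
move=> hS fl h; have f0 : f 0 = 0.
  by have := fl (-1) 0 0; rewrite scaler0 add0r scaleN1r addNr.
elim=> [|c Y Z hY _ hZ]; first by rewrite f0; case: hS.
by rewrite fl; apply: hS.2 => //; apply: h.
Qed.

Lemma span_incl m n (E S : 'M[F]_(m, n) -> Prop) X :
  subspace S -> (forall Y, E Y -> S Y) -> span E X -> S X.
Proof. by move=> hS h; apply: (@span_map _ _ _ _ _ _ id). Qed.

(** A map which sends a subspace into its sum with a line loses at most one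
    dimension: eliminate the component along the line between the images. *)
Lemma elimination m n (S : 'M[F]_(m, n) -> Prop) (L : Type)
    (op : L -> 'M[F]_(m, n) -> 'M[F]_(m, n)) :
  subspace S -> (forall l, linear (op l)) ->
  (forall l, exists e, forall X, S X -> exists Y c, S Y /\ op l X = Y + c *: e) ->
  forall (s : seq L) r (Z : 'I_r -> 'M[F]_(m, n)),
  (size s < r)%N -> (forall i, S (Z i)) ->
  exists2 c : 'I_r -> F, exists i, c i != 0 & S (foldr op (\sum_i c i *: Z i) s).
Proof.
move=> hS fl hop; elim/last_ind => [|s l IH] r Z.
  case: r Z => // r Z _ hZ; exists (fun i => (i == ord0)%:R).
    by exists ord0; rewrite eqxx oner_neq0.
  by apply: subspace_sum => // i; apply: subspaceZ.
case: r Z => // r Z; rewrite size_rcons ltnS => sr hZ; have [e he] := hop l.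
have fsum u (c : 'I_u -> F) (X : 'I_u -> 'M[F]_(m, n)) :
    op l (\sum_i c i *: X i) = \sum_i c i *: op l (X i).
  have f0 : op l 0 = 0 by have := fl l (-1) 0 0; rewrite scaler0 add0r scaleN1r addNr.
  by elim: (index_enum _) => [|i v IHv]; rewrite ?big_nil // !big_cons fl IHv.
have hY i : exists y : 'M[F]_(m, n) * F, S y.1 /\ op l (Z i) = y.1 + y.2 *: e.
  by have [Y [c [h1 h2]]] := he _ (hZ i); exists (Y, c).
have [y hy] := fin_all_exists hY.
have [p kp|k0] := pickP (fun i => (y i).2 != 0); last first.
  have [c [i ci] hc] := IH r.+1 (fun i => (y i).1) (ltnW sr) (fun i => (hy i).1).
  exists c; first by exists i.
  rewrite foldr_rcons fsum; under eq_bigr => j _.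
    rewrite (hy j).2 (eqP (negbFE (k0 j))) scale0r addr0; over.
  exact: hc.
(* Eliminate [e] with the pivot [p]. *)
pose k i := (y i).2 / (y p).2.
pose Z' (i : 'I_r) := (y (lift p i)).1 - k (lift p i) *: (y p).1.
have hZ' i : S (Z' i).
  by apply: subspaceB (hy _).1 _ => //; apply: subspaceZ (hy _).1.
have [c [i ci] hc] := IH r Z' sr hZ'.
pose c' i := if unlift p i is Some j then c j else - \sum_j c j * k (lift p j).
exists c'; first by exists (lift p i); rewrite /c' liftK.
rewrite foldr_rcons fsum (bigD1_ord p) //= /c' unlift_none.
under [X in foldr _ (_ + X)]eq_bigr => j _ do rewrite liftK.
suff -> : (- (\sum_j c j * k (lift p j))) *: op l (Z p) + \sum_j c j *: op l (Z (lift p j))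
  = \sum_j c j *: Z' j by [].
rewrite scaleNr scaler_suml -sumrN -big_split /=; apply: eq_bigr => j _.
rewrite !(hy _).2 /Z' /k; apply/matrixP => u v; rewrite !mxE.
by field.
Qed.

End Jets.

(** * Conjugation and tangent vectors *)

Section Tangent.
Variables (F : fieldType) (n : nat).
Hypothesis hF : [pchar F] =i pred0.
Local Notation M := 'M[F]_n.
Implicit Types (g h X Y : M) (H K : M -> Prop).

Definition Ad g X : M := g *m X *m invmx g.

Lemma Ad1 X : Ad 1%:M X = X.
Proof. by rewrite /Ad invmx1 mul1mx mulmx1. Qed.

Lemma invmxM g h : g \in unitmx -> h \in unitmx ->
  invmx (g *m h) = invmx h *m invmx g.
Proof.
move=> ug uh; have ugh : g *m h \in unitmx by rewrite unitmx_mul ug.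
have E : g *m h *m (invmx h *m invmx g) = 1%:M by rewrite mulmxA mulmxK // mulmxV.
by rewrite -[LHS]mulmx1 -E mulmxA mulVmx // mul1mx.
Qed.

Lemma AdM g h X : g \in unitmx -> h \in unitmx -> Ad (g *m h) X = Ad g (Ad h X).
Proof. by move=> ug uh; rewrite /Ad invmxM // !mulmxA. Qed.

Lemma Ad_linear g : linear (Ad g).
Proof.
by move=> c X Y; rewrite /Ad mulmxDr mulmxDl -scalemxAr -scalemxAl.
Qed.

Lemma AdZ g c X : Ad g (c *: X) = c *: Ad g X.
Proof. by rewrite /Ad -scalemxAr -scalemxAl. Qed.

Lemma AdKV g X : g \in unitmx -> Ad (invmx g) (Ad g X) = X.
Proof. by move=> ug; rewrite -AdM ?unitmx_inv // mulVmx // Ad1. Qed.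

Lemma Ad_eq0 g X : g \in unitmx -> Ad g X = 0 -> X = 0.
Proof. by move=> ug h; rewrite -[X](AdKV X ug) h /Ad mulmx0 mul0mx. Qed.

Lemma mjetJ g Γ A X : mjet Γ A X ->
  mjet (fun c => g *m Γ c *m invmx g) (Ad g A) (Ad g X).
Proof.
move=> h; have := mjetM (mjetM (mjet_cst g) h) (mjet_cst (invmx g)).
by rewrite mul0mx add0r mulmx0 addr0.
Qed.

(** These vectors lie in [lie H] by the chain rule; in contrast with
    [lie H], conjugation visibly carries them along. *)
Definition tangent H : M -> Prop :=
  span (fun X => exists2 Γ, mjet Γ 1%:M X & generic (fun c => H (Γ c))).

Lemma tangent_subspace H : subspace (tangent H).
Proof. exact: span_subspace. Qed.

Lemma lie_subspace H : subspace (lie H).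
Proof.
split=> [f _|c X Y hX hY f hf]; first by rewrite big1 // => l _; rewrite linear0 mxE mul0r.
under eq_bigr => l _ do rewrite linearP 2!mxE mulrDl -mulrA.
by rewrite big_split /= -mulr_sumr (hX f hf) (hY f hf) mulr0 add0r.
Qed.

Lemma tangent_lie H X : tangent H X -> lie H X.
Proof.
apply: span_incl; first exact: lie_subspace.
move=> Y [Γ jΓ hΓ] f hf.
have h : jet (fun c => f.@[mxvec (Γ c) 0]) f.@[mxvec (1%:M : M) 0]
    (\sum_l mxvec Y 0 l * (f^`M(l)).@[mxvec (1%:M : M) 0]).
  apply: (@jet_meval _ _ f (fun c => mxvec (Γ c) 0)) => l.
  case/mxvec_indexP: l => i j; rewrite !mxvecE; apply: jet_eq (jΓ i j).
  by apply: generic_all => c; rewrite mxvecE.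
apply: (proj2 (jet_unique hF _ h (jet_cst 0))).
by apply: genericS hΓ => c /hf.
Qed.

Lemma tangent_conj H K g X : g \in unitmx ->
  (forall h, H h -> K (g *m h *m invmx g)) -> tangent H X -> tangent K (Ad g X).
Proof.
move=> ug hHK; apply: span_map (Ad_linear g) _ => [|Y [Γ jΓ hΓ]].
  exact: tangent_subspace.
apply: span_in; exists (fun c => g *m Γ c *m invmx g); last by apply: genericS hΓ => c; apply: hHK.
by have := mjetJ g jΓ; rewrite {1}/Ad mulmx1 mulmxV.
Qed.

Lemma lieS H K X : included H K -> lie H X -> lie K X.
Proof. by move=> hHK h f hf; apply: h => g /hHK /hf. Qed.

End Tangent.

(** * Relations in SL_2 *)

Section SL2.
Variable F : fieldType.
Implicit Types (b c d s : F).

Lemma mx2M b c d s b' c' d' s' :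
  mx2 b c d s *m mx2 b' c' d' s' =
  mx2 (b * b' + c * d') (b * c' + c * s') (d * b' + s * d') (d * c' + s * s').
Proof. by rewrite /mx2 mulmx_block -!scalar_mxM -!raddfD. Qed.

Lemma det_mx2u b c s : \det (mx2 b c 0 s) = b * s.
Proof. by rewrite /mx2 raddf0 det_ublock !det_scalar !expr1. Qed.

Lemma det_mx2l b d s : \det (mx2 b 0 d s) = b * s.
Proof. by rewrite /mx2 raddf0 det_lblock !det_scalar !expr1. Qed.

Lemma sl2_swap c d : 1 + c * d != 0 -> let s := 1 + c * d in
  mx2 1 c 0 1 *m mx2 1 0 d 1 =
  mx2 1 0 (d / s) 1 *m (mx2 s 0 0 s^-1 *m mx2 1 (c / s) 0 1).
Proof.
by move=> s0 s; rewrite !mx2M; congr mx2; rewrite /s; field; rewrite ?s0 ?oner_neq0.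
Qed.

Lemma sl2_swapV c d : 1 + c * d != 0 -> let s := (1 + c * d)^-1 in
  mx2 1 0 d 1 *m mx2 1 c 0 1 =
  mx2 1 (c * s) 0 1 *m (mx2 s 0 0 s^-1 *m mx2 1 0 (d * s) 1).
Proof.
by move=> s0 s; rewrite !mx2M; congr mx2; rewrite /s; field; rewrite ?s0 ?oner_neq0.
Qed.

Lemma sl2_weyl c : c != 0 ->
  mx2 1 c 0 1 *m (mx2 1 0 (- c^-1) 1 *m mx2 1 c 0 1) =
  mx2 1 1 0 1 *m (mx2 1 0 (-1) 1 *m (mx2 1 1 0 1 *m mx2 c^-1 0 0 c)).
Proof. by move=> c0; rewrite !mx2M; congr mx2; field; rewrite ?c0 ?oner_neq0. Qed.

End SL2.

(** * Roots and reduced words *)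

Section Roots.
Variables (I : finType) (a : I -> I -> int).
Hypothesis ha : cartan a.
Local Notation V := {ffun I -> int}.
Local Notation act := (word_act a).
Implicit Types (x y z : V) (s t : seq I) (i j l : I).

Lemma vecP x y : (forall i, x i = y i :> int) -> x = y.
Proof. by move=> h; apply/ffunP. Qed.

Lemma ffunMzE x (n : int) i : (x *~ n) i = n * x i.
Proof.
have E m : (x *+ m) i = m%:Z * x i.
  elim: m => [|m IH]; first by rewrite mulr0n ffunE mul0r.
  by rewrite mulrS ffunE IH -addn1 PoszD mulrDl mul1r addrC.
by case: n => n; rewrite /intmul /= ?ffunE E // NegzE mulNr.
Qed.

Lemma ffunBE x y i : (x - y) i = x i - y i.
Proof. by rewrite !ffunE. Qed.

Lemma ffunNE x i : (- x) i = - x i.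
Proof. by rewrite !ffunE. Qed.

Lemma ffun0E i : (0 : V) i = 0.
Proof. by rewrite !ffunE. Qed.

Definition form x y : int := \sum_i \sum_j x i * a i j * y j.
Definition pairing i x : int := \sum_j x j * a i j.

Lemma simple_refl_pairing i x : simple_refl a i x = x - basisZ i *~ pairing i x.
Proof. by []. Qed.

Lemma simple_reflE i x j :
  simple_refl a i x j = x j - (i == j)%:R * pairing i x.
Proof. by rewrite /simple_refl !ffunE ffunMzE ffunE mulrC eq_sym. Qed.

Lemma formC x y : form x y = form y x.
Proof.
have [sa _ _ _] := ha; rewrite /form exchange_big /=.
by apply: eq_bigr => i _; apply: eq_bigr => j _; rewrite (sa i j); ring.
Qed.

Lemma formDl x y z : form (x + y) z = form x z + form y z.
Proof.
rewrite /form -big_split /=; apply: eq_bigr => i _; rewrite -big_split /=.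
by apply: eq_bigr => j _; rewrite ffunE !mulrDl.
Qed.

Lemma form_mulzl n x z : form (x *~ n) z = n * form x z.
Proof.
rewrite /form mulr_sumr; apply: eq_bigr => i _; rewrite mulr_sumr.
by apply: eq_bigr => j _; rewrite ffunMzE !mulrA.
Qed.

Lemma formBl x y z : form (x - y) z = form x z - form y z.
Proof.
rewrite formDl; congr (_ + _).
have -> : - y = y *~ (-1) by rewrite mulrN1z.
by rewrite form_mulzl mulN1r.
Qed.

Lemma formBr x y z : form z (x - y) = form z x - form z y.
Proof. by rewrite formC formBl !(formC z). Qed.

Lemma form_mulzr n x z : form z (x *~ n) = n * form z x.
Proof. by rewrite formC form_mulzl formC. Qed.

Lemma form_basis i x : form (basisZ i) x = pairing i x.
Proof.
rewrite /form (bigD1 i) //= [X in _ + X]big1 => [|j ji]; last first.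
  by rewrite big1 // => l _; rewrite ffunE (negbTE ji) !mul0r.
by rewrite addr0; apply: eq_bigr => j _; rewrite ffunE eqxx mul1r mulrC.
Qed.

Lemma pairing_basis i j : pairing i (basisZ j) = a i j.
Proof.
rewrite /pairing (bigD1 j) //= big1 => [|l lj].
  by rewrite ffunE eqxx mul1r addr0.
by rewrite ffunE (negbTE lj) mul0r.
Qed.

Lemma simple_reflB i : {morph simple_refl a i : x y / x - y}.
Proof.
move=> x y; apply: vecP => j; rewrite [RHS]ffunBE !simple_reflE [in LHS]ffunBE.
have -> : pairing i (x - y) = pairing i x - pairing i y.
  by rewrite -!form_basis formBr.
by ring.
Qed.

Lemma simple_refl_mulz i n x : simple_refl a i (x *~ n) = simple_refl a i x *~ n.
Proof.
apply: vecP => j; rewrite simple_reflE !ffunMzE simple_reflE.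
have -> : pairing i (x *~ n) = n * pairing i x.
  by rewrite -!form_basis form_mulzr.
by ring.
Qed.

Lemma form_refl i x y : form (simple_refl a i x) (simple_refl a i y) = form x y.
Proof.
have [_ _ a2 _] := ha.
rewrite !simple_refl_pairing !formBl !formBr !form_mulzl !form_mulzr.
by rewrite (formC x (basisZ i)) !form_basis pairing_basis a2; ring.
Qed.

Lemma simple_reflK i : involutive (simple_refl a i).
Proof.
have [_ _ a2 _] := ha; move=> x; apply: vecP => j; rewrite !simple_reflE.
have -> : pairing i (simple_refl a i x) = - pairing i x.
  rewrite -[LHS]form_basis simple_refl_pairing formBr form_mulzr !form_basis.
  by rewrite pairing_basis a2; ring.
by ring.
Qed.

Lemma act_cat s t x : act (s ++ t) x = act s (act t x).
Proof. by elim: s => //= i s ->. Qed.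

Lemma act_rcons s i x : act (rcons s i) x = act s (simple_refl a i x).
Proof. by rewrite -cats1 act_cat /=. Qed.

Lemma actB s : {morph act s : x y / x - y}.
Proof. by move=> x y; elim: s => //= i s ->; rewrite simple_reflB. Qed.

Lemma act_mulz s n x : act s (x *~ n) = act s x *~ n.
Proof. by elim: s => //= i s ->; rewrite simple_refl_mulz. Qed.

Lemma actN s x : act s (- x) = - act s x.
Proof. by rewrite -[- x]mulrN1z act_mulz mulrN1z. Qed.

Lemma actD s : {morph act s : x y / x + y}.
Proof. by move=> x y; rewrite -{1}[y]opprK actB actN opprK. Qed.

Lemma form_act s x y : form (act s x) (act s y) = form x y.
Proof. by elim: s => //= i s <-; rewrite form_refl. Qed.

Lemma form_gt0 x : x != 0 -> 0 < form x x.
Proof. by have [_ pos _ _] := ha; apply: pos. Qed.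

(** The off-diagonal terms of the quadratic form come in equal pairs and the
    diagonal ones are [2 * x i ^+ 2]. *)
Lemma form_even x : exists n : int, form x x = n * 2.
Proof.
have [sa _ a2 _] := ha.
pose f i j := x i * a i j * x j; pose r := @enum_rank I.
exists (\sum_i x i ^+ 2 + \sum_i \sum_(j | (r i < r j)%N) f i j).
rewrite /form mulrDl mulr_suml.
have -> : \sum_i \sum_j f i j = \sum_i x i ^+ 2 * 2 + \sum_i \sum_(j | j != i) f i j.
  rewrite -big_split /=; apply: eq_bigr => i _; rewrite (bigD1 i) //=.
  by rewrite /f a2; congr (_ + _); ring.
congr (_ + _).
have -> : \sum_i \sum_(j | j != i) f i j
  = \sum_i \sum_(j | (r i < r j)%N) f i j + \sum_i \sum_(j | (r j < r i)%N) f i j.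
  rewrite -big_split /=; apply: eq_bigr => i _.
  rewrite (bigID (fun j => (r i < r j)%N)) /=; congr (_ + _); apply: eq_bigl => j.
    by have [->|] := eqVneq j i; rewrite ?ltnn.
  by rewrite -leqNgt ltn_neqAle (inj_eq val_inj) (inj_eq enum_rank_inj).
rewrite [X in _ + X](exchange_big_dep predT) //= mulrDr mulr1; congr (_ + _).
apply: eq_bigr => i _; apply: eq_bigr => j _.
by rewrite /f (sa i j); ring.
Qed.

Definition nonneg x := forall i, 0 <= x i.

(** A vector with both positive and negative coordinates has square length at
    least [2 + 2], since the positive and the negative part pair to something
    nonpositive and a nonzero even positive integer is at least [2]. *)
Lemma root_sign x : form x x = 2 -> nonneg x \/ nonneg (- x).
Proof.
have [sa _ _ a01] := ha; move=> x2.
pose u : V := [ffun i => Num.max (x i) 0]; pose v : V := [ffun i => Num.max (- x i) 0].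
have Ex : x = u - v by apply: vecP => i; rewrite !ffunE; lia.
have uv : form u v <= 0.
  rewrite /form; apply: sumr_le0 => i _; apply: sumr_le0 => j _; rewrite !ffunE.
  have [<-|ij] := eqVneq i j; last by have [->|->] := a01 i j ij; nia.
  have [h|h] := leP (x i) 0; last by rewrite [Num.max (- x i) 0]max_r ?mulr0 //; lia.
  by rewrite !mul0r.
have ge2 y : y != 0 -> 2 <= form y y.
  by move=> /form_gt0; have [n ->] := form_even y; lia.
have [u0|/ge2 hu] := eqVneq u 0.
  by right=> i; move/ffunP: u0 => /(_ i); rewrite /u !ffunE oppr_ge0 => /max_idPr.
have [v0|/ge2 hv] := eqVneq v 0.
  by left=> i; move/ffunP: v0 => /(_ i); rewrite /v !ffunE -oppr_le0 => /max_idPr.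
move: x2; rewrite Ex formBl !formBr (formC v u); lia.
Qed.

Lemma root_neq0 x : form x x = 2 -> x != 0.
Proof.
move=> h; apply/eqP => x0; move: h; rewrite x0 /form big1 // => i _.
by rewrite big1 // => j _; rewrite ffunE !mul0r.
Qed.

Lemma root_nonnegN x : form x x = 2 -> nonneg x -> ~ nonneg (- x).
Proof.
move=> /root_neq0/eqP x0 h1 h2; apply: x0; apply: vecP => i.
by move: (h1 i) (h2 i); rewrite ffunNE ffun0E; lia.
Qed.

Lemma form_simple i : form (basisZ i) (basisZ i) = 2.
Proof. by have [_ _ a2 _] := ha; rewrite form_basis pairing_basis. Qed.

Lemma nonneg_simple i : nonneg (basisZ i).
Proof. by move=> j; rewrite ffunE; case: (_ == _). Qed.

(** A simple reflection changes only one coordinate, so a positive root that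
    it makes negative has no other coordinate, hence is the simple root. *)
Lemma refl_nonneg i x : form x x = 2 -> nonneg x -> x <> basisZ i ->
  nonneg (simple_refl a i x).
Proof.
move=> x2 x0 xi.
have [//|neg] : nonneg (simple_refl a i x) \/ nonneg (- simple_refl a i x).
  by apply: root_sign; rewrite form_refl.
have xj j : j != i -> x j = 0.
  move=> ji; have := neg j; rewrite ffunNE simple_reflE.
  by rewrite eq_sym (negbTE ji) mul0r subr0; have := x0 j; lia.
case: xi; have Ex : x = basisZ i *~ x i.
  apply: vecP => j; rewrite ffunMzE ffunE.
  by have [->|/xj ->] := eqVneq j i; rewrite ?mulr1 ?mulr0.
move: x2 (x0 i); rewrite {1 2}Ex form_mulzl form_mulzr form_simple => h1 h2.
by rewrite Ex (_ : x i = 1) //; nia.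
Qed.

Lemma refl_simple i : simple_refl a i (basisZ i) = - basisZ i.
Proof.
have [_ _ a2 _] := ha; rewrite simple_refl_basis a2.
by apply: vecP => j; rewrite ffunBE ffunNE ffunMzE; lia.
Qed.

Lemma form_act_simple s i : form (act s (basisZ i)) (act s (basisZ i)) = 2.
Proof. by rewrite form_act form_simple. Qed.

(** Along a word which makes a simple root negative, some letter changes the
    sign, and the root it is applied to must be the simple root of that letter. *)
Lemma sign_change s i : ~ nonneg (act s (basisZ i)) ->
  exists s1 l s2, s = s1 ++ l :: s2 /\ act s2 (basisZ i) = basisZ l.
Proof.
elim: s => [|l s IH] /= h; first by case: h; apply: nonneg_simple.
have [pos|/IH [s1 [l' [s2 [-> E]]]]] := classic (nonneg (act s (basisZ i))).
  exists [::], l, s; split=> //; apply: NNPP => ne; apply: h.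
  exact: refl_nonneg (form_act_simple _ _) pos ne.
by exists (l :: s1), l', s2.
Qed.

(** The root found by [sign_change] is simple and the image of the simple root
    [i], so its reflection is conjugate to that of [i]; deleting its letter
    amounts to appending [i]. *)
Lemma exchange s i : ~ nonneg (act s (basisZ i)) ->
  exists2 z, (size z).+1 = size s & act s =1 act (rcons z i).
Proof.
case/sign_change => s1 [l [s2 [-> E]]]; exists (s1 ++ s2).
  by rewrite !size_cat /= addnS.
move=> x; rewrite act_rcons !act_cat /=; congr (act s1 _).
rewrite !simple_refl_pairing actB act_mulz E.
by congr (_ - _ *~ _); rewrite -!form_basis -E form_act.
Qed.

Definition reduced s := forall t, act t =1 act s -> (size s <= size t)%N.

Lemma eq_act_reduced s t : act s =1 act t -> size s = size t -> reduced s -> reduced t.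
Proof. by move=> e es rs u hu; rewrite -es rs // => x; rewrite e. Qed.

Lemma act_cancel s t i : act (rcons s i) =1 act (rcons t i) -> act s =1 act t.
Proof. by move=> e x; have := e (simple_refl a i x); rewrite !act_rcons simple_reflK. Qed.

Lemma reduced_catl s t : reduced (s ++ t) -> reduced s.
Proof.
move=> r u hu; have := r (u ++ t); rewrite !size_cat leq_add2r; apply=> x.
by rewrite !act_cat hu.
Qed.

Lemma reduced_catr s t : reduced (s ++ t) -> reduced t.
Proof.
move=> r u hu; have := r (s ++ u); rewrite !size_cat leq_add2l; apply=> x.
by rewrite !act_cat hu.
Qed.

Lemma reduced_rcons_nonneg s i : reduced (rcons s i) -> nonneg (act s (basisZ i)).
Proof.
move=> r; apply: NNPP => /exchange [z ez h].
have := r z; rewrite size_rcons -ez ltnNge leqnSn => H; apply: (notF (H _)).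
by move=> x; rewrite act_rcons h act_rcons simple_reflK.
Qed.

(** A shorter word of the same element would send the simple root to a negative
    one, and exchange would shorten [s]. *)
Lemma nonneg_reduced_rcons s i : reduced s -> nonneg (act s (basisZ i)) ->
  reduced (rcons s i).
Proof.
move=> r h t ht.
have /exchange [z ez hz] : ~ nonneg (act t (basisZ i)).
  rewrite ht act_rcons refl_simple actN => h'.
  exact: root_nonnegN (form_act_simple s i) h h'.
rewrite size_rcons -ez ltnS; apply: r; apply: (@act_cancel _ _ i) => x.
by rewrite -hz ht.
Qed.

Lemma reduced_descent s i : reduced (rcons s i) ->
  ~ nonneg (act (rcons s i) (basisZ i)).
Proof.
move=> /reduced_rcons_nonneg h; rewrite act_rcons refl_simple actN => h'.
exact: root_nonnegN (form_act_simple s i) h h'.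
Qed.

(** * Braid moves *)

Inductive braid : seq I -> seq I -> Prop :=
| Braid3 s t i j : a i j = -1 ->
    braid (s ++ [:: i; j; i] ++ t) (s ++ [:: j; i; j] ++ t)
| Braid2 s t i j : a i j = 0 ->
    braid (s ++ [:: i; j] ++ t) (s ++ [:: j; i] ++ t).

Lemma refl_comm i j x : a i j = 0 ->
  simple_refl a i (simple_refl a j x) = simple_refl a j (simple_refl a i x).
Proof.
have [sa _ _ _] := ha; move=> aij; have aji : a j i = 0 by rewrite sa.
rewrite !simple_refl_pairing -!form_basis !formBr !form_mulzr.
by rewrite !form_basis !pairing_basis aji aij !mulr0 !subr0 addrAC.
Qed.

Lemma refl_braid i j x : a i j = -1 ->
  simple_refl a i (simple_refl a j (simple_refl a i x)) =
  simple_refl a j (simple_refl a i (simple_refl a j x)).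
Proof.
have [sa _ a2 _] := ha; move=> aij; have aji : a j i = -1 by rewrite sa.
rewrite !simple_refl_pairing -!form_basis !formBr !form_mulzr.
rewrite !form_basis !pairing_basis aji aij !a2.
by apply: vecP => l; rewrite !ffunBE !ffunMzE; ring.
Qed.

Lemma act_braid s t : braid s t -> act s =1 act t.
Proof.
by case=> s1 t1 i j aij x; rewrite !act_cat /=; congr (act s1 _);
  [apply: refl_braid|apply: refl_comm].
Qed.

Definition braids := clos_refl_trans _ braid.

Lemma braids_rcons s t i : braids s t -> braids (rcons s i) (rcons t i).
Proof.
elim=> [u v [s1 t1 l j h|s1 t1 l j h]|u|u v w _ h1 _ h2].
- by rewrite -!cats1 -!catA; apply/rt_step/Braid3.
- by rewrite -!cats1 -!catA; apply/rt_step/Braid2.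
- exact: rt_refl.
- exact: rt_trans h1 h2.
Qed.

Lemma nonneg_opp x : form x x = 2 -> nonneg (- x) -> ~ nonneg x.
Proof. by move=> h h1 h2; apply: root_nonnegN h h2 h1. Qed.

Lemma not_nonneg x : form x x = 2 -> ~ nonneg x -> nonneg (- x).
Proof. by move=> /root_sign []. Qed.

(** By induction on the length. If the last letters [i] and [j] differ, the
    element makes both simple roots negative; the exchange property then gives a
    reduced word of it which ends with one of the two reduced words of the
    longest element of the group generated by the two reflections, and a braid
    move exchanges these. *)
Theorem reduced_braids s t : reduced s -> act s =1 act t -> size s = size t ->
  braids s t.
Proof.
have [sa _ _ a01] := ha.
have [n] := ubnP (size s); elim: n => // n IH in s t *.
case/lastP: s => [|u i] sn rs est.
  by move/esym/size0nil => ->; apply: rt_refl.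
case/lastP: t est => [|v j] est; rewrite ?size_rcons // => -[suv].
have rt : reduced (rcons v j) by apply: eq_act_reduced rs; rewrite ?size_rcons ?suv.
have ru : reduced u by apply: (@reduced_catl _ [:: i]); rewrite cats1.
have rv : reduced v by apply: (@reduced_catl _ [:: j]); rewrite cats1.
move: sn; rewrite size_rcons ltnS => sn.
have [eij|ij] := eqVneq i j.
  rewrite -eij in est rt *; apply: braids_rcons; apply: IH => //.
  exact: act_cancel est.
have ni := reduced_descent rs.
have nj : ~ nonneg (act (rcons u i) (basisZ j)) by rewrite est; apply: reduced_descent.
case: (a01 i j ij) => aij; have aji : a j i = a i j by rewrite sa.
- have sij : simple_refl a i (basisZ j) = basisZ j.
    by rewrite simple_refl_basis aij mulr0z subr0.
  have /exchange [z ez hz] : ~ nonneg (act u (basisZ j)).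
    by move: nj; rewrite act_rcons sij.
  have uz : braids u (rcons z j) by apply: IH => //; rewrite size_rcons.
  apply: rt_trans (braids_rcons i uz) _.
  apply: (@rt_trans _ _ _ (rcons (rcons z i) j)).
    by rewrite -!cats1 -!catA /= -[[:: j; i]]cats0 -[[:: i; j]]cats0;
       apply/rt_step/Braid2; rewrite aji.
  have hv : act v =1 act (rcons z i).
    apply: (@act_cancel _ _ j) => x; rewrite -est !act_rcons hz act_rcons.
    by congr (act z _); apply: refl_comm; rewrite aji.
  apply: braids_rcons; apply: IH; rewrite ?size_rcons ?ez ?suv //.
  - by rewrite -suv.
  - by apply: eq_act_reduced rv => //; rewrite size_rcons ez suv.
- have sij : simple_refl a i (basisZ j) = basisZ i + basisZ j.
    by rewrite simple_refl_basis aij mulrN1z opprK addrC.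
  have sji : simple_refl a j (basisZ i) = basisZ i + basisZ j.
    by rewrite simple_refl_basis aji aij mulrN1z opprK.
  have sji' : simple_refl a j (basisZ i + basisZ j) = basisZ i.
    by rewrite -sji simple_reflK.
  have Ni : nonneg (- act (rcons u i) (basisZ i)).
    by apply: not_nonneg ni; apply: form_act_simple.
  have Nj : nonneg (- act (rcons u i) (basisZ j)).
    by apply: not_nonneg nj; apply: form_act_simple.
  have /exchange [z ez hz] : ~ nonneg (act u (basisZ j)).
    apply: nonneg_opp; first exact: form_act_simple.
    have -> : act u (basisZ j) = act (rcons u i) (basisZ i + basisZ j).
      by rewrite act_rcons -sij simple_reflK.
    by rewrite actD => l; rewrite opprD ffunE addr_ge0.
  have /exchange [y ey hy] : ~ nonneg (act z (basisZ i)).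
    have -> : act z (basisZ i) = act (rcons u i) (basisZ j).
      by rewrite act_rcons hz act_rcons sij sji'.
    exact: nj.
  have rz : reduced z.
    apply: (@reduced_catl _ [:: j]); rewrite cats1.
    by apply: eq_act_reduced ru; rewrite ?size_rcons.
  have huz x : act u x = act y (simple_refl a i (simple_refl a j x)).
    by rewrite hz act_rcons hy act_rcons.
  have uz : braids u (rcons (rcons y i) j).
    by apply: IH; rewrite ?size_rcons ?ey // => x; rewrite huz !act_rcons.
  apply: rt_trans (braids_rcons i uz) _.
  apply: (@rt_trans _ _ _ (rcons (rcons (rcons y j) i) j)).
    by rewrite -!cats1 -!catA /= -[[:: i; j; i]]cats0 -[[:: j; i; j]]cats0;
       apply/rt_step/Braid3.
  have hv : act v =1 act (rcons (rcons y j) i).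
    apply: (@act_cancel _ _ j) => x; rewrite -est !act_rcons huz.
    by rewrite refl_braid.
  apply: braids_rcons; apply: IH; rewrite ?size_rcons ?ey ?ez ?suv //.
  - by rewrite -suv.
  - by apply: eq_act_reduced rv => //; rewrite !size_rcons ey ez suv.
Qed.

Lemma act_inj s : injective (act s).
Proof.
by elim: s => //= i s IH x y /(congr1 (simple_refl a i)); rewrite !simple_reflK => /IH.
Qed.

(** Equality would mean that [t] sends the simple root [l] to the opposite of
    the simple root [i], against the positivity of reduced words. *)
Lemma inversions_neq s i t l : reduced (rcons (s ++ i :: t) l) ->
  act s (basisZ i) <> act (s ++ i :: t) (basisZ l).
Proof.
rewrite rcons_cat => /reduced_catr; rewrite -[rcons _ l]/([:: i] ++ rcons t l).
move=> /reduced_catr/reduced_rcons_nonneg h; rewrite act_cat /= => /act_inj.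
move/(congr1 (simple_refl a i)); rewrite simple_reflK refl_simple => E.
by apply: (@root_nonnegN (basisZ i)); rewrite ?form_simple ?E //; apply: nonneg_simple.
Qed.

(** * Words of the longest element *)

Section Longest.
Variables (w0 : V -> V) (nu : nat).
Hypothesis hw0 : longest a w0 nu.

Lemma longest_reduced s : act s =1 w0 -> size s = nu -> reduced s.
Proof.
by move=> e es t ht; rewrite es; apply: hw0.1.2 => x; rewrite ht e.
Qed.

(** Otherwise the word could be prolonged to a longer reduced word. *)
Lemma longest_rcons i : exists2 z, (size z).+1 = nu & act (rcons z i) =1 w0.
Proof.
have [[s es hs] _] := hw0.1; have rs := longest_reduced hs es.
have [h|/exchange [z ez hz]] := classic (nonneg (act s (basisZ i))); last first.
  by exists z; rewrite ?ez // => x; rewrite -hz.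
have r := nonneg_reduced_rcons rs h.
suff : (nu < nu)%N by rewrite ltnn.
rewrite -{1}es -(size_rcons s i); apply: (hw0.2 (act (rcons s i))); split=> //.
by exists (rcons s i).
Qed.

Local Notation ptZ := (pt I nu tropZ).
Local Notation adjacentZ := (@adjacent _ a nu w0 tropZ).

Definition pt_nonneg (x : ptZ) := forall o : 'I_nu, 0 <= (tnth x.2 o : int).

Lemma trop_move_nonneg (b c d b' c' d' : int) :
  b' = c + d - Num.min b d -> c' = Num.min b d -> d' = b + c - Num.min b d ->
  [/\ 0 <= b, 0 <= c & 0 <= d] <-> [/\ 0 <= b', 0 <= c' & 0 <= d'].
Proof. by move=> -> -> ->; split=> -[h1 h2 h3]; split; lia. Qed.

Lemma adjacent_nonneg (x y : ptZ) : adjacentZ x y -> (pt_nonneg x <-> pt_nonneg y).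
Proof.
case=> _ _ [].
- case=> p [q [r [i [j [[_ _ _ off] [_ [_ /= [vp vq vr]]]]]]]].
  have mv := trop_move_nonneg vp vq vr.
  split=> h o; have [|/off [_ E]] := boolP (o \in [:: p; q; r]).
  + have [h1 h2 h3] : [/\ 0 <= (tnth y.2 p : int), 0 <= (tnth y.2 q : int)
        & 0 <= (tnth y.2 r : int)] by apply/mv; split; apply: h.
    by rewrite !inE; case/or3P=> /eqP ->.
  + by rewrite E; apply: h.
  + have [h1 h2 h3] : [/\ 0 <= (tnth x.2 p : int), 0 <= (tnth x.2 q : int)
        & 0 <= (tnth x.2 r : int)] by apply/mv; split; apply: h.
    by rewrite !inE; case/or3P=> /eqP ->.
  + by rewrite -E; apply: h.
- case=> p [q [i [j [[_ _ off] [_ [vp vq]]]]]].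
  split=> h o; have [|/off [_ E]] := boolP (o \in [:: p; q]).
  + by rewrite !inE; case/orP=> /eqP ->; rewrite ?vp ?vq; apply: h.
  + by rewrite E; apply: h.
  + by rewrite !inE; case/orP=> /eqP ->; rewrite -?vp -?vq; apply: h.
  + by rewrite -E; apply: h.
Qed.

Lemma pt_equiv_nonneg (x y : ptZ) : @pt_equiv _ a nu w0 tropZ x y -> (pt_nonneg x <-> pt_nonneg y).
Proof.
elim=> [u v|u|u v _ []|u v w _ [] ? ? _ [] ? ?].
- exact: adjacent_nonneg.
- by [].
- by split.
- by split; auto.
Qed.

Lemma tnth_cat_in (T : Type) (w : nu.-tuple T) (o : 'I_nu) (u1 u2 u3 : seq T) d :
  w = u1 ++ u2 ++ u3 :> seq T -> (size u1 <= o < size u1 + size u2)%N ->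
  tnth w o = nth d u2 (o - size u1).
Proof.
move=> e /andP[h1 h2]; rewrite (tnth_nth d) e nth_cat ltnNge h1 /= nth_cat.
by rewrite ltn_subLR // h2.
Qed.

Lemma tnth_cat_out (T : Type) (w w' : nu.-tuple T) (o : 'I_nu) (u1 u2 u2' u3 : seq T) :
  w = u1 ++ u2 ++ u3 :> seq T -> w' = u1 ++ u2' ++ u3 :> seq T ->
  size u2 = size u2' -> ~~ (size u1 <= o < size u1 + size u2)%N ->
  tnth w' o = tnth w o.
Proof.
move=> e e' es; pose d := tnth w o => h.
rewrite (tnth_nth d) [RHS](tnth_nth d) e e' !nth_cat; case: ltnP => // h1.
by move: h; rewrite h1 /= -leqNgt -es => h; rewrite !ltn_subLR // ltnNge h.
Qed.

Lemma adjacent_exists (x : ptZ) (t : seq I) :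
  @is_word _ a nu w0 x.1 -> braid x.1 t ->
  exists2 y : ptZ, y.1 = t :> seq I & adjacentZ x y.
Proof.
move=> wx b; have ab := act_braid b.
have st : size t == nu.
  have <- : size x.1 = size t by case: b => s1 s2 i j _; rewrite !size_cat.
  by rewrite size_tuple.
have wy : @is_word _ a nu w0 (Tuple st) by move=> v; rewrite -wx ab.
move Es: (tval x.1) b => s b; case: b Es st ab wy => s1 s2 i j aij Es st ab wy.
- have lt u : (u < 3)%N -> (size s1 + u < nu)%N.
    by move=> hu; rewrite -(eqP st) !size_cat /= ltn_add2l ltn_addr.
  pose o u (h : (u < 3)%N) := Ordinal (lt u h).
  pose p := o 0 isT; pose q := o 1%N isT; pose r := o 2%N isT.
  pose m : int := Num.min (tnth x.2 p : int) (tnth x.2 r : int).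
  pose w := [tuple if l == p then (tnth x.2 q : int) + (tnth x.2 r : int) - m
    else if l == q then m else if l == r then (tnth x.2 p : int) + (tnth x.2 q : int) - m
    else (tnth x.2 l : int) | l < nu].
  exists (Tuple st, w : nu.-tuple tropZ); first by [].
  split=> //; left; exists p, q, r, i, j.
  have inX u (h : (u < 3)%N) : (size s1 <= o u h < size s1 + 3)%N.
    by rewrite leq_addr ltn_add2l h.
  have E u (h : (u < 3)%N) : tnth x.1 (o u h) = nth i [:: i; j; i] u
     /\ tnth (Tuple st) (o u h) = nth i [:: j; i; j] u.
    rewrite (tnth_cat_in (u1 := s1) (u2 := [:: i; j; i]) (u3 := s2) i) //.
    rewrite (tnth_cat_in (u1 := s1) (u2 := [:: j; i; j]) (u3 := s2) i) //.
    by rewrite /= addKn.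
  split.
    split=> //; rewrite /= ?addn0 ?addn1 ?addn2 // => l.
    rewrite !inE !negb_or => /and3P[lp lq lr]; split; last first.
      by rewrite tnth_mktuple (negbTE lp) (negbTE lq) (negbTE lr).
    apply: (tnth_cat_out (u1 := s1) (u2 := [:: i; j; i]) (u2' := [:: j; i; j]) (u3 := s2)) => //.
    by move: lp lq lr; rewrite -!val_eqE /= => *; lia.
  have [E0 E0'] := E 0 isT; have [E1 E1'] := E 1%N isT; have [E2 E2'] := E 2%N isT.
  split; first by [].
  split; first by [].
  by rewrite /= !tnth_mktuple -!val_eqE /= !eqn_add2l.
- have lt u : (u < 2)%N -> (size s1 + u < nu)%N.
    by move=> hu; rewrite -(eqP st) !size_cat /= ltn_add2l ltn_addr.
  pose o u (h : (u < 2)%N) := Ordinal (lt u h).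
  pose p := o 0 isT; pose q := o 1%N isT.
  pose w := [tuple if l == p then tnth x.2 q
    else if l == q then tnth x.2 p else tnth x.2 l | l < nu].
  exists (Tuple st, w : nu.-tuple tropZ); first by [].
  split=> //; right; exists p, q, i, j.
  have inX u (h : (u < 2)%N) : (size s1 <= o u h < size s1 + 2)%N.
    by rewrite leq_addr ltn_add2l h.
  have E u (h : (u < 2)%N) : tnth x.1 (o u h) = nth i [:: i; j] u
     /\ tnth (Tuple st) (o u h) = nth i [:: j; i] u.
    rewrite (tnth_cat_in (u1 := s1) (u2 := [:: i; j]) (u3 := s2) i) //.
    rewrite (tnth_cat_in (u1 := s1) (u2 := [:: j; i]) (u3 := s2) i) //.
    by rewrite /= addKn.
  split.
    split=> //; rewrite /= ?addn0 ?addn1 // => l.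
    rewrite !inE !negb_or => /andP[lp lq]; split; last first.
      by rewrite tnth_mktuple (negbTE lp) (negbTE lq).
    apply: (tnth_cat_out (u1 := s1) (u2 := [:: i; j]) (u2' := [:: j; i]) (u3 := s2)) => //.
    by move: lp lq; rewrite -!val_eqE /= => *; lia.
  have [E0 E0'] := E 0 isT; have [E1 E1'] := E 1%N isT.
  split; first by [].
  by rewrite /= !tnth_mktuple -!val_eqE /= !eqn_add2l.
Qed.

Lemma braids_equiv (x : ptZ) (t : seq I) :
  @is_word _ a nu w0 x.1 -> braids x.1 t ->
  exists2 y : ptZ, y.1 = t :> seq I & @pt_equiv _ a nu w0 tropZ x y.
Proof.
move=> wx b.
suff [y [ey _ xy]] : exists y : ptZ,
    [/\ y.1 = t :> seq I, @is_word _ a nu w0 y.1 & @pt_equiv _ a nu w0 tropZ x y].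
  by exists y.
elim: (clos_rt_rtn1 _ _ _ _ b) => [|u v uv _ [y [ey wy xy]]].
  by exists x; split=> //; apply: rst_refl.
rewrite -ey in uv; have [z ez yz] := adjacent_exists wy uv; exists z; split=> //.
  by case: yz.
by apply: rst_trans xy _; apply: rst_step.
Qed.

(** Braid moves lead from the given word to one which ends in [i], and they
    preserve nonnegative tropical coordinates. *)
Lemma nonneg_representative i (x : ptZ) : @is_word _ a nu w0 x.1 -> pt_nonneg x ->
  exists y : ptZ, [/\ @is_word _ a nu w0 y.1, @pt_equiv _ a nu w0 tropZ x y,
    pt_nonneg y & exists s, y.1 = rcons s i :> seq I].
Proof.
move=> wx nx; have [z ez hz] := longest_rcons i.
have xz : act x.1 =1 act (rcons z i) by move=> v; rewrite wx hz.
have sx : size x.1 = size (rcons z i) by rewrite size_tuple size_rcons.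
have rx := longest_reduced wx (size_tuple _).
have [y ey xy] := braids_equiv wx (reduced_braids rx xz sx).
exists y; split=> //.
- by move=> v; rewrite ey hz.
- by apply/(pt_equiv_nonneg xy).
- by exists z.
Qed.

End Longest.

End Roots.

Section Pinned.
Variables (k : closedFieldType) (I : finType) (a : I -> I -> int).
Hypotheses (hk : [pchar k] =i pred0) (ha : cartan a).
Variable G : pinned_group k a.

Local Notation n := (pg_dim G).
Local Notation M := 'M[k]_n.
Local Notation GG := (@pg_G k I a G).
Local Notation T := (@pg_T k I a G).
Local Notation Bp := (@pg_Bp k I a G).
Local Notation Bm := (@pg_Bm k I a G).
Local Notation α := (@pg_root k I a G).
Local Notation x := (@pg_x k I a G).
Local Notation y := (@pg_y k I a G).

Definition coroot i (s : k) : M := pg_sl2 G i (mx2 s 0 0 s^-1).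

Implicit Types (i j l : I) (c d s : k) (t g X Y : M).

(** * Elementary consequences of the axioms *)

Lemma subgroup_Bp : subgroup Bp.
Proof. by case: (pg_borelp G) => -[[]]. Qed.
Lemma subgroup_Bm : subgroup Bm.
Proof. by case: (pg_borelm G) => -[[]]. Qed.
Lemma subgroup_T : subgroup T.
Proof. by case: (pg_torus G) => -[[]]. Qed.
Lemma subgroup_G : subgroup GG.
Proof. by case: (pg_alg G). Qed.

Lemma T_Bp t : T t -> Bp t. Proof. by case/pg_opposite. Qed.
Lemma T_Bm t : T t -> Bm t. Proof. by case/pg_opposite. Qed.
Lemma Bp_G g : Bp g -> GG g. Proof. by case: (pg_borelp G) => _ h _; apply: h. Qed.
Lemma Bm_G g : Bm g -> GG g. Proof. by case: (pg_borelm G) => _ h _; apply: h. Qed.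
Lemma T_unit t : T t -> t \in unitmx. Proof. by case: subgroup_T => h _ _ _; apply: h. Qed.

Lemma x_Bp i c : Bp (x i c). Proof. by case: (pg_xroot G i). Qed.
Lemma y_Bm i c : Bm (y i c). Proof. by case: (pg_yroot G i). Qed.
Lemma x_unit i c : x i c \in unitmx.
Proof. by case: subgroup_Bp => h _ _ _; apply: h; apply: x_Bp. Qed.
Lemma y_unit i c : y i c \in unitmx.
Proof. by case: subgroup_Bm => h _ _ _; apply: h; apply: y_Bm. Qed.

Lemma x_add i c d : x i (c + d) = x i c *m x i d. Proof. by case: (pg_xroot G i). Qed.
Lemma y_add i c d : y i (c + d) = y i c *m y i d. Proof. by case: (pg_yroot G i). Qed.

Lemma x_zero i : x i 0 = 1%:M.
Proof.
have := x_add i 0 0; rewrite addr0 => e.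
by rewrite -(mulVmx (x_unit i 0)) {3}e mulKmx // x_unit.
Qed.

Lemma y_zero i : y i 0 = 1%:M.
Proof.
have := y_add i 0 0; rewrite addr0 => e.
by rewrite -(mulVmx (y_unit i 0)) {3}e mulKmx // y_unit.
Qed.

Lemma x_inv i c : invmx (x i c) = x i (- c).
Proof. by rewrite -[RHS](mulKmx (x_unit i c)) -x_add subrr x_zero mulmx1. Qed.

Lemma y_inv i c : invmx (y i c) = y i (- c).
Proof. by rewrite -[RHS](mulKmx (y_unit i c)) -y_add subrr y_zero mulmx1. Qed.

Lemma torus_x i t c : T t -> t *m x i c = x i (α i t * c) *m t.
Proof.
case: (pg_xroot G i) => _ _ _ _ h ht; rewrite -(h t c ht).
by rewrite mulmxKV // T_unit.
Qed.

Lemma torus_y i t c : T t -> t *m y i c = y i ((α i t)^-1 * c) *m t.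
Proof.
case: (pg_yroot G i) => _ _ _ _ h ht; rewrite -(h t c ht).
by rewrite mulmxKV // T_unit.
Qed.

Lemma root_char i : is_character T (α i).
Proof. by case: (pg_base G) => h _ _; case: (h i). Qed.

Lemma pg_root_neq0 i t : T t -> α i t != 0.
Proof. by case: (root_char i) => h _ _; apply: h. Qed.

Lemma pg_rootM i t g : T t -> T g -> α i (t *m g) = α i t * α i g.
Proof. by case: (root_char i) => _ h _; apply: h. Qed.

Lemma torus_one : T 1%:M. Proof. by case: subgroup_T. Qed.
Lemma torus_mul t g : T t -> T g -> T (t *m g). Proof. by case: subgroup_T => _ _ h _; apply: h. Qed.

Lemma pg_root1 i : α i 1%:M = 1.
Proof.
apply: (mulfI (pg_root_neq0 i torus_one)); rewrite -pg_rootM ?mulmx1 ?mulr1 //; exact: torus_one.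
Qed.

Lemma sl2M i (g h : 'M[k]_(1 + 1)) : \det g = 1 -> \det h = 1 ->
  pg_sl2 G i (g *m h) = pg_sl2 G i g *m pg_sl2 G i h.
Proof. by case: (pg_sl2_hom G i) => _ hm _; apply: hm. Qed.

Lemma coroot_T i s : s != 0 -> T (coroot i s).
Proof. exact: pg_sl2T. Qed.

Lemma coroot_root i j s : s != 0 -> α j (coroot i s) = s ^ a i j.
Proof. exact: pg_cartan. Qed.

Lemma x_y_swap i c d : 1 + c * d != 0 -> let s := 1 + c * d in
  x i c *m y i d = y i (d / s) *m coroot i s *m x i (c / s).
Proof.
move=> s0 s; rewrite -!pg_sl2x -!pg_sl2y -sl2M ?det_mx2u ?det_mx2l ?mulr1 //.
rewrite (sl2_swap s0) !sl2M ?mulmxA // ?det_mulmx ?det_mx2u ?det_mx2l ?mulr1 ?divff //.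
Qed.

Lemma y_x_swap i c d : 1 + c * d != 0 -> let s := (1 + c * d)^-1 in
  y i d *m x i c = x i (c * s) *m coroot i s *m y i (d * s).
Proof.
move=> s0 s; rewrite -!pg_sl2x -!pg_sl2y -sl2M ?det_mx2u ?det_mx2l ?mulr1 //.
have s'0 : s != 0 by rewrite invr_eq0.
by rewrite (sl2_swapV s0) !sl2M ?mulmxA // ?det_mulmx ?det_mx2u ?det_mx2l ?mulr1 ?divff.
Qed.

(** A representative of the simple reflection in the normalizer of [T]. *)
Definition refl_rep i : M := x i 1 *m (y i (-1) *m x i 1).

Lemma refl_rep_unit i : refl_rep i \in unitmx.
Proof. by rewrite !unitmx_mul !x_unit y_unit. Qed.

Lemma T_refl_rep i t : T t ->
  t *m refl_rep i = refl_rep i *m (coroot i (α i t)^-1 *m t).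
Proof.
move=> ht; have a0 := pg_root_neq0 i ht; rewrite /refl_rep.
rewrite (mulmxA t) (torus_x _ _ ht) -(mulmxA _ t) (mulmxA t) (torus_y _ _ ht).
rewrite -(mulmxA _ t) (torus_x _ _ ht) !mulr1 mulrN1 !mulmxA; congr (_ *m t).
have := sl2_weyl a0; move/(congr1 (pg_sl2 G i)).
rewrite !sl2M ?det_mulmx ?det_mx2u ?det_mx2l ?mulVf ?mulr1 ?mul1r // !pg_sl2x !pg_sl2y.
by rewrite /coroot invrK !mulmxA.
Qed.

(** * Velocities of the one-parameter subgroups *)

Section Generators.

(** The root homomorphisms as polynomial curves, and the velocities of the
    coroots at [1]. *)
Variables (xp yp : I -> 'M[{poly k}]_n) (ch : I -> M).
Hypothesis xpE : forall i c, x i c = mxeval (xp i) c.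
Hypothesis ypE : forall i c, y i c = mxeval (yp i) c.
Hypothesis chE : forall i (s : k -> k) b, jet s 1 b ->
  mjet (fun c => coroot i (s c)) 1%:M (b *: ch i).

Definition ce i : M := mxcoef (xp i) 1.
Definition cf i : M := mxcoef (yp i) 1.

Lemma jet_x i (s : k -> k) b : jet s 0 b -> mjet (fun c => x i (s c)) 1%:M (b *: ce i).
Proof.
move=> h u v; rewrite -(x_zero i) xpE !mxE.
have -> : ((xp i) u v)`_1 = ((xp i) u v)^`().[0] by rewrite horner_coef0 coef_deriv.
apply: jet_eq (jet_comp_horner _ h); apply: generic_all => c.
by rewrite xpE mxE.
Qed.

Lemma jet_y i (s : k -> k) b : jet s 0 b -> mjet (fun c => y i (s c)) 1%:M (b *: cf i).
Proof.
move=> h u v; rewrite -(y_zero i) ypE !mxE.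
have -> : ((yp i) u v)`_1 = ((yp i) u v)^`().[0] by rewrite horner_coef0 coef_deriv.
apply: jet_eq (jet_comp_horner _ h); apply: generic_all => c.
by rewrite ypE mxE.
Qed.

Lemma jet_x1 i : mjet (x i) 1%:M (ce i).
Proof. by have := jet_x i (@jet_id k); rewrite scale1r. Qed.

Lemma jet_y1 i : mjet (y i) 1%:M (cf i).
Proof. by have := jet_y i (@jet_id k); rewrite scale1r. Qed.

Lemma jetMU (Γ Γ' : k -> M) X Y : mjet Γ 1%:M X -> mjet Γ' 1%:M Y ->
  mjet (fun c => Γ c *m Γ' c) 1%:M (X + Y).
Proof. by move=> h h'; have := mjetM h h'; rewrite !mulmx1 mul1mx. Qed.

Lemma jetJU g (Γ : k -> M) X : g \in unitmx -> mjet Γ 1%:M X ->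
  mjet (fun c => g *m Γ c *m invmx g) 1%:M (Ad g X).
Proof. by move=> ug h; have := mjetJ g h; rewrite {1}/Ad mulmx1 mulmxV. Qed.

Lemma jetU_unique (Γ Γ' : k -> M) X Y : mjet Γ 1%:M X -> mjet Γ' 1%:M Y ->
  generic (fun c => Γ c = Γ' c) -> X = Y.
Proof. by move=> h h' e; apply: (mjet_unique hk e h h'). Qed.

Lemma generic_affine c d : c != 0 -> generic (fun b => c + d * b != 0).
Proof.
move=> c0; have h : c%:P + d *: 'X != 0 :> {poly k}.
  apply: contraNneq c0 => /(congr1 (fun p => p.[0])).
  by rewrite !(hornerD, hornerC, hornerZ, hornerX) mulr0 addr0 ?horner0 => ->.
apply: genericS (generic_neq0 h) => b.
by rewrite !(hornerD, hornerC, hornerZ, hornerX).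
Qed.

Lemma jet_affine c d : jet (fun b => c + d * b) c d.
Proof.
have := jetD (jet_cst c) (jetZ d (@jet_id k)); rewrite mulr0 addr0 mulr1 add0r.
by [].
Qed.

(** Both sides are velocities at [b = 0]: of [x i c *m y i b *m x i (- c)]
    and of its factorization in the big cell. *)
Lemma Ad_x_f i c : Ad (x i c) (cf i) = cf i + c *: ch i - c ^+ 2 *: ce i.
Proof.
have js : jet (fun b => 1 + c * b) 1 c := jet_affine 1 c.
have jV : jet (fun b => (1 + c * b)^-1) 1 (- c).
  by have := jetV (oner_neq0 _) js; rewrite invr1 expr1n divr1.
have jm : jet (fun b => b * (1 + c * b)^-1) 0 1.
  by have := jetM (@jet_id k) jV; rewrite !mul0r mulr1 addr0.
have j3 : jet (fun b => c * (1 + c * b)^-1 + - c) 0 (- c ^+ 2).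
  have := jetD (jetZ c jV) (jet_cst (- c)); rewrite mulr1 subrr addr0 mulrN.
  by rewrite expr2.
have j := jetMU (jetMU (jet_y i jm) (chE i js)) (jet_x i j3).
have := jetU_unique (jetJU (x_unit i c) (jet_y1 i)) j.
rewrite scale1r scaleNr; apply.
apply: genericS (generic_affine c (oner_neq0 k)) => b hb.
by rewrite x_y_swap // x_inv x_add !mulmxA.
Qed.

Lemma Ad_y_e i c : Ad (y i c) (ce i) = ce i - c *: ch i - c ^+ 2 *: cf i.
Proof.
have js : jet (fun b => 1 + - c * b) 1 (- c) := jet_affine 1 (- c).
have jV : jet (fun b => (1 + - c * b)^-1) 1 c.
  by have := jetV (oner_neq0 _) js; rewrite invr1 expr1n divr1 opprK.
have jm : jet (fun b => b * (1 + - c * b)^-1) 0 1.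
  by have := jetM (@jet_id k) jV; rewrite !mul0r mulr1 addr0.
have j3 : jet (fun b => c + - c * (1 + - c * b)^-1) 0 (- c ^+ 2).
  have := jetD (jet_cst c) (jetZ (- c) jV); rewrite mulr1 subrr add0r mulNr.
  by rewrite expr2.
have j := jetMU (jetMU (jet_y i j3) (chE i js)) (jet_x i jm).
have := jetU_unique (jetJU (y_unit i c) (jet_x1 i)) j.
rewrite scale1r !scaleNr => ->; first by rewrite addrC addrA addrAC.
apply: genericS (generic_affine (- c) (oner_neq0 k)) => b hb.
rewrite y_inv -mulmxA x_y_swap; last by rewrite mulrC.
by rewrite [b * - c]mulrC y_add !mulmxA.
Qed.

(** The derivative of [s ^ m] is [m] at [s = 1]. *)
Lemma jet_exprz (s : k -> k) b (m : int) : jet s 1 b ->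
  jet (fun c => s c ^ m) 1 (m%:~R * b).
Proof.
move=> js.
have jn (r : nat) : jet (fun c => s c ^+ r) 1 (r%:R * b).
  elim: r => [|r IH]; first by rewrite mul0r; apply: jet_cst.
  have := jetM js IH; rewrite !mulr1 mul1r.
  have -> : b + r%:R * b = r.+1%:R * b by rewrite -natr1; ring.
  by apply: jet_eq; apply: generic_all => c; rewrite exprS.
case: m => r; first exact: jn.
have := jetV (oner_neq0 _) (jn r.+1); rewrite invr1 expr1n divr1.
by rewrite NegzE mulrNz mulNr.
Qed.

(** [x i c] commutes with [coroot l s] up to a factor [x i] whose parameter is a
    power of [s]; differentiate at [s = 1]. *)
Lemma Ad_x_h i l c : Ad (x i c) (ch l) = ch l - ((a l i)%:~R * c) *: ce i.
Proof.
have js : jet (fun b => 1 + 1 * b) 1 1 := jet_affine 1 1.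
have jp : jet (fun b => (1 + 1 * b) ^ (- a l i) * c + - c) 0 (- (a l i)%:~R * c).
  have := jetD (jetM (jet_exprz (- a l i) js) (jet_cst c)) (jet_cst (- c)).
  by rewrite !(mulr1, mul1r, mulr0, addr0, subrr, mulrNz).
have j0 := chE l js; rewrite scale1r in j0.
have := jetU_unique (jetJU (x_unit i c) j0) (jetMU j0 (jet_x i jp)).
rewrite mulNr scaleNr; apply.
apply: genericS (generic_affine 1 (oner_neq0 k)) => b; set s := 1 + 1 * b => s0.
have sV : s ^ (- a l i) = (s ^ a l i)^-1 by rewrite invr_expz.
rewrite x_inv x_add !mulmxA; congr (_ *m _).
rewrite (torus_x _ _ (coroot_T l s0)) (coroot_root _ _ s0) mulrA; congr (x i _ *m _).
by rewrite sV divff ?mul1r // expfz_neq0.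
Qed.

Lemma Ad_y_h i l c : Ad (y i c) (ch l) = ch l + ((a l i)%:~R * c) *: cf i.
Proof.
have js : jet (fun b => 1 + 1 * b) 1 1 := jet_affine 1 1.
have jp : jet (fun b => (1 + 1 * b) ^ (a l i) * c + - c) 0 ((a l i)%:~R * c).
  have := jetD (jetM (jet_exprz (a l i) js) (jet_cst c)) (jet_cst (- c)).
  by rewrite !(mulr1, mul1r, mulr0, addr0, subrr).
have j0 := chE l js; rewrite scale1r in j0.
apply: (jetU_unique (jetJU (y_unit i c) j0) (jetMU j0 (jet_y i jp))).
apply: genericS (generic_affine 1 (oner_neq0 k)) => b; set s := 1 + 1 * b => s0.
rewrite y_inv y_add !mulmxA; congr (_ *m _).
rewrite (torus_y _ _ (coroot_T l s0)) (coroot_root _ _ s0) mulrA; congr (y i _ *m _).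
by rewrite mulVf ?mul1r // expfz_neq0.
Qed.

Lemma Ad_T_e i t : T t -> Ad t (ce i) = α i t *: ce i.
Proof.
move=> ht; have jp : jet (fun b => α i t * b) 0 (α i t).
  by have := jetZ (α i t) (@jet_id k); rewrite mulr0 mulr1.
apply: (jetU_unique (jetJU (T_unit ht) (jet_x1 i)) (jet_x i jp)).
by apply: generic_all => b; rewrite torus_x // mulmxK // T_unit.
Qed.

Lemma Ad_T_f i t : T t -> Ad t (cf i) = (α i t)^-1 *: cf i.
Proof.
move=> ht; have jp : jet (fun b => (α i t)^-1 * b) 0 (α i t)^-1.
  by have := jetZ (α i t)^-1 (@jet_id k); rewrite mulr0 mulr1.
apply: (jetU_unique (jetJU (T_unit ht) (jet_y1 i)) (jet_y i jp)).
by apply: generic_all => b; rewrite torus_y // mulmxK // T_unit.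
Qed.

(** Otherwise the one-parameter group [y i] would be constant. *)
Lemma cf_neq0 i : cf i != 0.
Proof.
apply/eqP => f0; have const c : y i c = 1%:M.
  rewrite -(y_zero i) !ypE; apply: (curve_constant hk) => d.
  have := mjetM (mjet_cst (y i d)) (jet_y1 i).
  rewrite mulmx1 mul0mx f0 mulmx0 addr0 -ypE; apply: mjet_eq.
  by apply: generic_all => b; rewrite -ypE y_add.
have [_ inj _ _ _] := pg_yroot G i.
have := oner_neq0 k; rewrite (inj 1 0) ?eqxx //.
by have := const 1; have := const 0 => -> ->.
Qed.


(** * Weights of the torus on matrices *)

Section Weights.
Variable Pd : M.
Hypothesis Pd_unit : Pd \in unitmx.
Hypothesis Pd_diag : forall t, T t -> is_diag_mx (Pd *m t *m invmx Pd).

(** [Ad Pd X] is [X] in a basis of eigenvectors of [T]; [eig t u] is the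
    eigenvalue of [t] on the [u]-th of them. *)
Definition eig t u := Ad Pd t u u.
Definition weight u v t := eig t u / eig t v.

Lemma Ad_mul g X Y : g \in unitmx -> Ad g (X *m Y) = Ad g X *m Ad g Y.
Proof. by move=> ug; rewrite /Ad !mulmxA mulmxKV. Qed.

Lemma Ad_T_off t u v : T t -> u != v -> Ad Pd t u v = 0.
Proof. by move=> /Pd_diag/is_diag_mxP h uv; apply: h. Qed.

Lemma Ad_mulT t X u v : T t -> Ad Pd (t *m X) u v = eig t u * Ad Pd X u v.
Proof.
move=> ht; rewrite Ad_mul // mxE (bigD1 u) //= big1 ?addr0 // => w wu.
by rewrite (Ad_T_off ht) ?mul0r // eq_sym.
Qed.

Lemma Ad_mulTr t X u v : T t -> Ad Pd (X *m t) u v = Ad Pd X u v * eig t v.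
Proof.
move=> ht; rewrite Ad_mul // mxE (bigD1 v) //= big1 ?addr0 // => w wu.
by rewrite (Ad_T_off ht) ?mulr0.
Qed.

Lemma eigM t t' u : T t -> T t' -> eig (t *m t') u = eig t u * eig t' u.
Proof. by move=> ht ht'; rewrite /eig Ad_mulT. Qed.

Lemma eig1 u : eig 1%:M u = 1.
Proof. by rewrite /eig /Ad mulmx1 mulmxV // mxE eqxx. Qed.

Lemma torus_inv t : T t -> T (invmx t).
Proof. by case: subgroup_T => _ _ _ h; apply: h. Qed.

Lemma eigV t u : T t -> eig (invmx t) u = (eig t u)^-1.
Proof.
move=> ht; have e : eig (invmx t) u * eig t u = 1.
  by rewrite -eigM ?mulVmx ?eig1 ?T_unit //; apply: torus_inv.
have e0 : eig t u != 0 by apply: contra_eq_neq e => ->; rewrite mulr0 eq_sym oner_neq0.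
by rewrite -[LHS](mulfK e0) e mul1r.
Qed.

Lemma eig_neq0 t u : T t -> eig t u != 0.
Proof.
move=> ht; have := eigM u (torus_inv ht) ht; rewrite mulVmx ?eig1 ?T_unit // => e.
by apply: contra_eq_neq e => ->; rewrite mulr0 oner_neq0.
Qed.

Lemma weight_neq0 t u v : T t -> weight u v t != 0.
Proof. by move=> ht; rewrite mulf_neq0 ?invr_eq0 ?eig_neq0. Qed.

Lemma Ad_T_entry t X u v : T t -> Ad Pd (Ad t X) u v = weight u v t * Ad Pd X u v.
Proof.
move=> ht; rewrite {1}/(Ad t X) Ad_mulTr; last exact: torus_inv.
by rewrite Ad_mulT // -/(eig _ _) eigV // mulrAC.
Qed.

Lemma Ad_Pd_inj X Y : (forall u v, Ad Pd X u v = Ad Pd Y u v) -> X = Y.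
Proof. by move=> h; rewrite -[X](AdKV X Pd_unit) -[Y](AdKV Y Pd_unit); congr Ad; apply/matrixP. Qed.

Lemma Ad_Pd_neq0 X : X != 0 -> exists u v, Ad Pd X u v != 0.
Proof.
move=> X0; apply: NNPP => h; case/eqP: X0; apply: Ad_Pd_inj => u v.
have -> : Ad Pd 0 = 0 by rewrite /Ad mulmx0 mul0mx.
rewrite [RHS]mxE; apply/eqP; apply: contraT => e.
by case: h; exists u, v.
Qed.

Lemma Ad_PdZ c X u v : Ad Pd (c *: X) u v = c * Ad Pd X u v.
Proof. by rewrite AdZ mxE. Qed.

Lemma weight_eq t c X u v : T t -> Ad t X = c *: X -> Ad Pd X u v != 0 -> c = weight u v t.
Proof.
move=> ht e h; apply: (mulIf h); rewrite -Ad_T_entry // e; exact/esym/Ad_PdZ.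
Qed.

Lemma T_comm t t' : T t -> T t' -> t *m t' = t' *m t.
Proof.
move=> ht ht'; apply: Ad_Pd_inj => u v; rewrite Ad_mulT // Ad_mulTr //.
by have [->|uv] := eqVneq u v; [rewrite mulrC|rewrite (Ad_T_off ht') // mulr0 mul0r].
Qed.

Lemma Ad_T_h l t : T t -> Ad t (ch l) = ch l.
Proof.
move=> ht; have j0 := chE l (jet_affine 1 1); rewrite scale1r in j0.
apply: (jetU_unique (jetJU (T_unit ht) j0) j0).
apply: genericS (generic_affine 1 (oner_neq0 k)) => b s0.
by rewrite (T_comm ht (coroot_T l s0)) mulmxK // T_unit.
Qed.

Lemma det_eig t : T t -> \det t = \prod_u eig t u.
Proof.
move=> ht; rewrite -[RHS](det_trig (A := Ad Pd t)); last exact/is_diag_mx_is_trig/Pd_diag.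
by rewrite !det_mulmx mulrAC -det_mulmx mulmxV // det1 mul1r.
Qed.

(** The inverse of an eigenvalue is the product of the others divided by the
    determinant, hence regular. *)
Lemma weight_char u v : is_character T (weight u v).
Proof.
split=> [t ht|t t' ht ht'|]; first exact: weight_neq0.
  by rewrite /weight !eigM // invfM; ring.
pose D w : {mpoly k[n * n]} :=
  \sum_i \sum_j (Pd w i * invmx Pd j w) *: 'X_(mxvec_index i j).
have DE w t : (D w).@[mxvec t 0] = eig t w.
  rewrite /D /eig /Ad -mulmxA mxE raddf_sum /=; apply: eq_bigr => i _.
  rewrite raddf_sum mxE mulr_sumr /=; apply: eq_bigr => j _.
  by rewrite mevalZ mevalXU mxvecE; ring.
exists (D u * \prod_(w | w != v) D w), 1%N => t ht.
rewrite mevalM rmorph_prod DE expr1 det_eig // (bigD1 (P := xpredT) v) //=.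
under eq_bigr do rewrite DE.
have P0 : \prod_(w | w != v) eig t w != 0 by apply/prodf_neq0 => w _; apply: eig_neq0.
by rewrite /weight invfM mulrACA divff // mulr1.
Qed.

Lemma weight_root (H : M -> Prop) X (χ : M -> k) : X != 0 -> lie H X ->
  (forall t, T t -> Ad t X = χ t *: X) ->
  (forall t, T t -> χ t = 1) \/
  exists2 γ, is_root T H γ & forall t, T t -> γ t = χ t.
Proof.
move=> X0 hX hw; have [u [v Xuv]] := Ad_Pd_neq0 X0.
have e t : T t -> weight u v t = χ t by move=> ht; rewrite (weight_eq ht (hw t ht) Xuv).
have [h|h] := classic (forall t, T t -> χ t = 1).
  by left.
have [t ht t1] : exists2 t, T t & χ t <> 1.
  apply: NNPP => h'; apply: h => t ht; apply: NNPP => t1; apply: h'.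
  by exists t.
right; exists (weight u v) => //; split; first exact: weight_char.
  by exists t => //; rewrite e //; apply/eqP.
by exists X; split=> // t' ht'; rewrite -/(Ad t' X) hw // e.
Qed.

(** The simple roots are independent characters. *)
Definition rchar (z : I -> int) t := \prod_j α j t ^ z j.

Lemma rchar_inj (z z' : I -> int) : (forall t, T t -> rchar z t = rchar z' t) -> z =1 z'.
Proof.
case: (pg_base G) => _ indep _ h j.
suff /(_ j)/eqP : forall j, z j - z' j = 0 by rewrite subr_eq0 => /eqP.
apply: indep => t ht.
have -> : \prod_i α i t ^ (z i - z' i) = rchar z t / rchar z' t.
  rewrite /rchar -prodfV -big_split; apply: eq_bigr => i _ /=.
  by rewrite expfzDr ?pg_root_neq0 // invr_expz.
rewrite h // divff //; apply/prodf_neq0 => i _.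
by rewrite expfz_neq0 // pg_root_neq0.
Qed.

(** A weight on the Lie algebra of [G] is trivial or a root, and exponents with
    respect to the simple roots are unique. *)
Lemma lie_weight X (z : I -> int) : X != 0 -> lie GG X ->
  (forall t, T t -> Ad t X = rchar z t *: X) ->
  (forall j, 0 <= z j) \/ (forall j, z j <= 0).
Proof.
move=> X0 hX hw; case: (weight_root X0 hX hw) => [h|[γ γroot γE]].
  left=> j; have -> // : z j = 0; apply: (@rchar_inj z (fun=> 0)) => t ht.
  by rewrite h // /rchar big1.
case: (pg_base G) => _ _ /(_ γ γroot) [[_ [m hm]]|[_ [m hm]]].
  left=> j; have -> // : z j = m j.
  by apply: (@rchar_inj z (fun j => m j)) => t ht; rewrite -γE // hm.
right=> j; have -> : z j = - (m j : int); last by rewrite oppr_le0.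
apply: (@rchar_inj z (fun j => - (m j : int))) => t ht; rewrite -γE // hm //.
by rewrite /rchar -prodfV; apply: eq_bigr => i _; rewrite -invr_expz.
Qed.

Lemma tangent_f j : tangent Bm (cf j).
Proof.
by apply: span_in; exists (y j); [apply: jet_y1|apply: generic_all => c; apply: y_Bm].
Qed.

Lemma mxcoef_weight (Z : 'M[{poly k}]_n) t (c d : k) (l : nat) :
  (forall b, Ad t (mxeval Z b) = c *: mxeval Z (d * b)) ->
  Ad t (mxcoef Z l) = (c * d ^+ l) *: mxcoef Z l.
Proof.
move=> h; have E : mxconst t *m Z *m mxconst (invmx t) = mxconst c%:M *m mxscale d Z.
  apply: (mxeval_inj hk) => b; rewrite !mxevalM !mxeval_const mxeval_scale.
  by rewrite mul_scalar_mx -h.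
have := congr1 (fun Z : 'M[{poly k}]_n => mxcoef Z l) E.
rewrite mxcoefMconst !mxcoef_constM mxcoef_scale mul_scalar_mx scalerA.
by [].
Qed.

(** The coefficient of [c ^+ m] in [Ad (x i c) (cf j)] lies in the Lie algebra
    of [G] and has weight [m] times the root [i] minus the root [j], which is
    neither a root nor trivial when [m] is positive. *)
Lemma Ad_x_f_neq i j c : i != j -> Ad (x i c) (cf j) = cf j.
Proof.
move=> ij; pose Z := xp i *m mxconst (cf j) *m mxscale (-1) (xp i).
have ZE b : mxeval Z b = Ad (x i b) (cf j).
  by rewrite !mxevalM mxeval_const mxeval_scale -!xpE mulN1r -x_inv.
have Z0 m : mxcoef Z m.+1 = 0.
  apply/eqP; apply: contraT => Zm.
  pose z l : int := (if l == i then m.+1%:Z else 0) - (l == j)%:Z.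
  have wz t : T t -> Ad t (mxcoef Z m.+1) = rchar z t *: mxcoef Z m.+1.
    move=> ht; have -> : rchar z t = (α j t)^-1 * α i t ^+ m.+1.
      rewrite /rchar (bigD1 i) //= (bigD1 j) 1?eq_sym //= big1 ?mulr1.
        rewrite /z eqxx (negbTE ij) subr0 eq_sym (negbTE ij) eqxx sub0r mulrC.
        by rewrite -invr_expz expr1z.
      by move=> l /andP[/negbTE li /negbTE lj]; rewrite /z li lj subr0 expr0z.
    apply: mxcoef_weight => b; rewrite !ZE -AdM ?x_unit ?T_unit // torus_x //.
    by rewrite AdM ?x_unit ?T_unit // Ad_T_f // AdZ.
  have lz : lie GG (mxcoef Z m.+1).
    apply: (subspace_coef hk) (lie_subspace _) _.
    apply: generic_all => b; rewrite ZE; apply: (tangent_lie hk).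
    case: subgroup_G => _ _ hM hV; apply: tangent_conj (tangent_f j).
      exact: x_unit.
    move=> g hg; have hx : GG (x i b) by apply/Bp_G/x_Bp.
    by apply: (hM); [apply: (hM) => //; apply: Bm_G|apply: hV].
  case: (lie_weight Zm lz wz) => [/(_ j)|/(_ i)].
    by rewrite /z eq_sym (negbTE ij) eqxx.
  by rewrite /z eqxx (negbTE ij).
rewrite -ZE (mxeval_coef0 _ Z0).
by rewrite ZE x_zero Ad1.
Qed.

(** The commutator is a polynomial curve in [d], and by [Ad_x_f_neq] its
    velocity vanishes everywhere. *)
Lemma x_y_comm i j c d : i != j -> x i c *m y j d = y j d *m x i c.
Proof.
move=> ij.
pose Z := mxconst (x i c) *m yp j *m mxconst (x i (- c)) *m mxscale (-1) (yp j).
have ZE b : mxeval Z b = x i c *m y j b *m x i (- c) *m y j (- b).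
  by rewrite !mxevalM !mxeval_const mxeval_scale -!ypE mulN1r.
have w0 : mjet (fun b => x i c *m y j b *m invmx (x i c) *m y j (- b)) 1%:M 0.
  have jN : jet (fun b : k => - b) 0 (-1) by have := jetN (@jet_id k); rewrite oppr0.
  have := jetMU (jetJU (x_unit i c) (jet_y1 j)) (jet_y j jN).
  by rewrite Ad_x_f_neq // scaleN1r subrr.
have E : mxeval Z d = mxeval Z 0.
  apply: (curve_constant hk) => b; have := mjetM (mjetM (mjet_cst (x i c *m y j b *m x i (- c))) w0)
    (mjet_cst (y j (- b))).
  rewrite !(mulmx0, mul0mx, mulmx1, addr0) -ZE; apply: mjet_eq.
  apply: generic_all => b'; rewrite ZE opprD [- b + _]addrC !y_add -x_inv !mulmxA.
  by rewrite mulmxKV // x_unit.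
move: E; rewrite !ZE oppr0 y_zero !mulmx1 -x_add subrr x_zero -x_inv -y_inv => E.
have := congr1 (fun X => X *m y j d *m x i c) E.
by rewrite /= !mulmxKV ?x_unit ?y_unit // mul1mx.
Qed.

Lemma Ad_y_e_neq i j c : i != j -> Ad (y j c) (ce i) = ce i.
Proof.
move=> ij; apply: (jetU_unique (jetJU (y_unit j c) (jet_x1 i)) (jet_x1 i)).
by apply: generic_all => b; rewrite -x_y_comm // mulmxK // y_unit.
Qed.

(** * The negative nilpotent algebra *)

Inductive lower_group : M -> Prop :=
| lower1 : lower_group 1%:M
| lower_y i c b : lower_group b -> lower_group (y i c *m b)
| lower_T t b : T t -> lower_group b -> lower_group (t *m b).

(** [nminus] and [bminus] play the part of the nilpotent radical and of the
    whole of a Borel subalgebra, [pminus i] that of the minimal parabolic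
    subalgebra which contains [ce i]. As a span of conjugates, [nminus] is stable
    under [lower_group] and tangent to [Bm]. *)
Definition nminus_gen X := exists b i, lower_group b /\ X = Ad b (cf i).
Definition bminus_gen X := nminus_gen X \/ exists i, X = ch i.
Definition nminus : M -> Prop := span nminus_gen.
Definition bminus : M -> Prop := span bminus_gen.
Definition pminus i : M -> Prop := span (fun X => bminus_gen X \/ X = ce i).

Lemma lower_unit b : lower_group b -> b \in unitmx.
Proof.
elim=> [|i c b' _ ub|t b' ht _ ub]; first exact: unitmx1.
  by rewrite unitmx_mul y_unit.
by rewrite unitmx_mul T_unit.
Qed.

Lemma lower_Bm b : lower_group b -> Bm b.
Proof.
case: subgroup_Bm => _ h1 hM _; elim=> [|i c b' _ hb|t b' ht _ hb] //.
  by apply: (hM) => //; apply: y_Bm.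
by apply: (hM) => //; apply: T_Bm.
Qed.

Lemma nminus_bminus X : nminus X -> bminus X.
Proof.
by apply: span_incl => [|Y hY]; [apply: span_subspace|apply: span_in; left].
Qed.

Lemma bminus_pminus i X : bminus X -> pminus i X.
Proof.
by apply: span_incl => [|Y hY]; [apply: span_subspace|apply: span_in; left].
Qed.

Lemma cf_nminus i : nminus (cf i).
Proof. by apply: span_in; exists 1%:M, i; split; [apply: lower1|rewrite Ad1]. Qed.

Lemma Ad_T_nminus t X : T t -> nminus X -> nminus (Ad t X).
Proof.
move=> ht; apply: span_map (Ad_linear t) _ => [|Y [b [i [hb ->]]]]; first exact: span_subspace.
apply: span_in; exists (t *m b), i; split; first exact: lower_T.
by rewrite (AdM _ (T_unit ht) (lower_unit hb)).
Qed.

Lemma Ad_y_nminus j c X : nminus X -> nminus (Ad (y j c) X).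
Proof.
apply: span_map (Ad_linear _) _ => [|Y [b [i [hb ->]]]]; first exact: span_subspace.
apply: span_in; exists (y j c *m b), i; split; first exact: lower_y.
by rewrite (AdM _ (y_unit _ _) (lower_unit hb)).
Qed.

Lemma Ad_y_bminus j c X : bminus X -> bminus (Ad (y j c) X).
Proof.
apply: span_map (Ad_linear _) _ => [|Y [hY|[l ->]]]; first exact: span_subspace.
  by apply/nminus_bminus/Ad_y_nminus/span_in.
rewrite Ad_y_h; apply: subspaceD; first exact: span_subspace.
  by apply: span_in; right; exists l.
by apply: subspaceZ; [apply: span_subspace|apply/nminus_bminus/cf_nminus].
Qed.

Lemma Ad_T_bminus t X : T t -> bminus X -> bminus (Ad t X).
Proof.
move=> ht; apply: span_map (Ad_linear _) _ => [|Y [hY|[l ->]]]; first exact: span_subspace.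
  by apply/nminus_bminus/Ad_T_nminus/span_in.
by rewrite Ad_T_h //; apply: span_in; right; exists l.
Qed.

Lemma ce_pminus i : pminus i (ce i).
Proof. by apply: span_in; right. Qed.

Lemma ch_bminus l : bminus (ch l).
Proof. by apply: span_in; right; exists l. Qed.

Lemma pminus_subspace i : subspace (pminus i).
Proof. exact: span_subspace. Qed.

Lemma Ad_y_pminus i j c X : pminus i X -> pminus i (Ad (y j c) X).
Proof.
have hS := pminus_subspace i.
apply: span_map (Ad_linear _) _ => // Y [hY|->]; first by apply/bminus_pminus/Ad_y_bminus/span_in.
have [<-|ij] := eqVneq i j; last by rewrite Ad_y_e_neq //; apply: ce_pminus.
rewrite Ad_y_e; apply: subspaceB => //; last first.
  by apply: subspaceZ => //; apply/bminus_pminus/nminus_bminus/cf_nminus.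
apply: subspaceB => //; first exact: ce_pminus.
by apply: subspaceZ => //; apply/bminus_pminus/ch_bminus.
Qed.

Lemma Ad_T_pminus i t X : T t -> pminus i X -> pminus i (Ad t X).
Proof.
move=> ht; have hS := pminus_subspace i.
apply: span_map (Ad_linear _) _ => // Y [hY|->]; first by apply/bminus_pminus/Ad_T_bminus/span_in.
by rewrite Ad_T_e //; apply: subspaceZ => //; apply: ce_pminus.
Qed.

(** [Ad (x i c)] commutes with [Ad (y j d)] for [j != i], and for [j = i] and
    generic [d] the product is reordered in the big cell of [SL_2]; the
    remaining values of [d] follow by [subspace_value]. *)
Lemma Ad_x_pminus i c X : pminus i X -> pminus i (Ad (x i c) X).
Proof.
have hS := pminus_subspace i.
pose S X := forall c, pminus i (Ad (x i c) X).
have S_e : S (ce i).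
  move=> d; suff -> : Ad (x i d) (ce i) = ce i by apply: ce_pminus.
  apply: (jetU_unique (jetJU (x_unit i d) (jet_x1 i)) (jet_x1 i)).
  by apply: generic_all => b; rewrite -x_add addrC x_add mulmxK // x_unit.
have S_h l : S (ch l).
  move=> d; rewrite Ad_x_h; apply: subspaceB => //; first exact/bminus_pminus/ch_bminus.
  by apply: subspaceZ => //; apply: ce_pminus.
have S_f j : S (cf j).
  move=> d; have [<-|ij] := eqVneq i j; last first.
    by rewrite Ad_x_f_neq //; apply/bminus_pminus/nminus_bminus/cf_nminus.
  rewrite Ad_x_f; apply: subspaceB => //; last first.
    by apply: subspaceZ => //; apply: ce_pminus.
  apply: subspaceD => //; first exact/bminus_pminus/nminus_bminus/cf_nminus.
  by apply: subspaceZ => //; apply/bminus_pminus/ch_bminus.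
have S_T t Y : T t -> S Y -> S (Ad t Y).
  move=> ht hY d; rewrite -AdM ?x_unit ?T_unit //.
  have a0 := pg_root_neq0 i ht.
  have -> : x i d *m t = t *m x i ((α i t)^-1 * d) by rewrite torus_x // mulVKf.
  by rewrite AdM ?x_unit ?T_unit //; apply: Ad_T_pminus.
have S_y j d Y : S Y -> S (Ad (y j d) Y).
  move=> hY b; rewrite -AdM ?x_unit ?y_unit //.
  have [<-|ij] := eqVneq i j; last first.
    by rewrite x_y_comm // AdM ?x_unit ?y_unit //; apply: Ad_y_pminus.
  pose Z := mxconst (x i b) *m yp i *m mxconst Y *m mxscale (-1) (yp i) *m mxconst (x i (- b)).
  have ZE d' : mxeval Z d' = Ad (x i b *m y i d') Y.
    rewrite !mxevalM !mxeval_const mxeval_scale -!ypE mulN1r.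
    by rewrite /Ad invmxM ?x_unit ?y_unit // x_inv y_inv !mulmxA.
  rewrite -ZE; apply: (subspace_value hk) => //.
  apply: genericS (generic_affine b (oner_neq0 k)) => d' s0.
  rewrite ZE x_y_swap // !AdM ?unitmx_mul ?y_unit ?x_unit ?T_unit //; last exact: coroot_T.
    by apply: Ad_y_pminus; apply: Ad_T_pminus; [apply: coroot_T|apply: hY].
  exact: coroot_T.
have S_sub : subspace S.
  split=> [d|d Y Y' hY hY' b]; first by rewrite /Ad mulmx0 mul0mx; case: hS.
  by rewrite Ad_linear; case: hS => _; apply.
move=> hX; suff : S X by apply.
apply: span_incl S_sub _ hX => Y [[[b [j [hb ->]]]|[l ->]]|->] //.
elim: hb => [|l d b' hb IH|t b' ht hb IH]; first by rewrite Ad1.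
  by rewrite (AdM _ (y_unit _ _) (lower_unit hb)); apply: S_y.
by rewrite (AdM _ (T_unit ht) (lower_unit hb)); apply: S_T.
Qed.

Lemma Ad_x_bminus i c X : bminus X -> exists Y d, bminus Y /\ Ad (x i c) X = Y + d *: ce i.
Proof. by move=> hX; apply: span_split; apply/Ad_x_pminus/bminus_pminus. Qed.

Lemma bminus_tangent X : bminus X -> tangent Bm X.
Proof.
apply: span_incl; first exact: tangent_subspace.
case: subgroup_Bm => _ _ hM hV.
move=> Y [[b [i [hb ->]]]|[l ->]].
  have hb' := lower_Bm hb; apply: tangent_conj (tangent_f i); first exact: lower_unit.
  by move=> g hg; apply: (hM); [apply: (hM)|apply: hV].
have j0 := chE l (jet_affine 1 1); rewrite scale1r in j0.
apply: span_in; exists (fun c => coroot l (1 + 1 * c)) => //.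
by apply: genericS (generic_affine 1 (oner_neq0 k)) => b /(coroot_T l)/T_Bm.
Qed.

(** * The grading by an element of the torus *)

Section Grading.
Variables (t0 : M) (ht : I -> nat).
Hypothesis t0_T : T t0.
Hypothesis ht_gt0 : forall j, (0 < ht j)%N.
Hypothesis root_t0 : forall j, α j t0 = 2 ^+ ht j.

Lemma pow2_neq1 m : (0 < m)%N -> 2 ^+ m != 1 :> k.
Proof.
case: m => // m _; apply/eqP; rewrite -natrX.
by move/(@natf_inj _ hk (2 ^ m.+1)%N 1%N)/eqP; rewrite -{2}(expn0 2) eqn_exp2l.
Qed.

Lemma pow2_neq0 m : 2 ^+ m != 0 :> k.
Proof. by rewrite -natrX ((pcharf0P k).1 hk) expn_eq0. Qed.

(** [X] is supported in the weights [2 ^- m], [m >= r], of [t0]. *)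
Definition low r X := forall u v, Ad Pd X u v != 0 ->
  exists2 m, (r <= m)%N & eig t0 u * 2 ^+ m = eig t0 v.

Lemma Ad_Pd_linear c X Y u v :
  Ad Pd (c *: X + Y) u v = c * Ad Pd X u v + Ad Pd Y u v.
Proof. by rewrite Ad_linear; move: (Ad Pd X) (Ad Pd Y) => A B; rewrite !mxE. Qed.

Lemma low_subspace r : subspace (low r).
Proof.
split=> [u v|c X Y hX hY u v]; first by rewrite /Ad mulmx0 mul0mx mxE eqxx.
rewrite Ad_Pd_linear => h.
have [X0|/hX //] := eqVneq (Ad Pd X u v) 0.
by apply: hY; move: h; rewrite X0 mulr0 add0r.
Qed.

Lemma low_weight r m X : (r <= m)%N -> Ad t0 X = (2 ^+ m)^-1 *: X -> low r X.
Proof.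
move=> rm hX u v Xuv; exists m => //; have := weight_eq t0_T hX Xuv => e.
have v0 := eig_neq0 v t0_T; have m0 := pow2_neq0 m.
by rewrite -[eig t0 u](divfK v0) -/(weight u v t0) -e mulrAC mulVf // mul1r.
Qed.

Lemma lowM (r s : nat) X Y : low r X -> low s Y -> low (r + s) (X *m Y).
Proof.
move=> hX hY u v; rewrite Ad_mul // mxE => h.
have [w hw] : exists w, Ad Pd X u w * Ad Pd Y w v != 0.
  apply: NNPP => h'; case/eqP: h; apply: big1 => w _; apply/eqP; apply: contraT => e.
  by case: h'; exists w.
move: hw; rewrite mulf_eq0 negb_or => /andP[/hX [m rm em] /hY [m' sm em']].
by exists (m + m')%N; rewrite ?leq_add // exprD mulrA em.
Qed.

Lemma low0M X Y : low 0 X -> low 0 Y -> low 0 (X *m Y).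
Proof. by move=> hX hY; exact: (lowM hX hY). Qed.

Lemma low_T t : T t -> low 0 t.
Proof.
move=> hT u v; have [<-|uv] := eqVneq u v; last by rewrite (Ad_T_off hT) // eqxx.
by exists 0%N => //; rewrite mulr1.
Qed.

Lemma low_y j c : low 0 (y j c).
Proof.
rewrite ypE; have [r ->] := mxeval_coef (yp j) c.
apply: subspace_sum => [|l]; first exact: low_subspace.
apply: (subspaceZ _ (low_subspace 0)).
apply: (@low_weight _ (ht j * l)) => //.
rewrite exprM -exprVn -[X in X *: _]mul1r -root_t0; apply: mxcoef_weight => b.
by rewrite -!ypE scale1r /Ad torus_y // mulmxK // T_unit.
Qed.

Lemma low_f j : low 1 (cf j).
Proof. by apply: (@low_weight _ (ht j)) => //; rewrite Ad_T_f // root_t0. Qed.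

Lemma low_Ad r g X : low 0 g -> low 0 (invmx g) -> low r X -> low r (Ad g X).
Proof. by move=> hg hg' hX; have := lowM (lowM hg hX) hg'; rewrite addn0 add0n. Qed.

Lemma lower_low b : lower_group b -> low 0 b /\ low 0 (invmx b).
Proof.
have low1 : low 0 1%:M by apply: low_T; apply: torus_one.
elim=> [|i c b' hb [h h']|t b' hT hb [h h']]; first by rewrite invmx1.
  rewrite invmxM ?y_unit ?lower_unit // y_inv; split; apply: low0M => //;
  exact: low_y.
rewrite (invmxM (T_unit hT) (lower_unit hb)); split; apply: low0M => //.
  exact: low_T.
by apply: low_T; apply: torus_inv.
Qed.

Lemma nminus_low X : nminus X -> low 1 X.
Proof.
apply: span_incl => [|Y [b [i [hb ->]]]]; first exact: low_subspace.
by have [h h'] := lower_low hb; apply: low_Ad => //; apply: low_f.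
Qed.

(** Operators [Ad t - c] separate the weights, so every weight which occurs in
    a vector tangent to [Bp] is the weight of a vector of the Lie algebra of
    [Bp], hence trivial or a product of simple roots. *)
Lemma tangent_Bp_weight X u v : tangent Bp X -> Ad Pd X u v != 0 ->
  exists m, eig t0 u = 2 ^+ m * eig t0 v.
Proof.
move=> hX Xuv.
have sep (p : 'I_n * 'I_n) : exists t, T t /\
    ((forall t', T t' -> weight p.1 p.2 t' = weight u v t') \/
     weight p.1 p.2 t != weight u v t).
  have [h|h] := classic (forall t', T t' -> weight p.1 p.2 t' = weight u v t').
    by exists 1%:M; split; [apply: torus_one|left].
  apply: NNPP => h'; apply: h => t' hT'; apply/eqP; apply: contraT => e; case: h'.
  by exists t'; split; [|right].
have [tt htt] := fin_all_exists sep.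
pose op (p : 'I_n * 'I_n) Y := Ad (tt p) Y - weight p.1 p.2 (tt p) *: Y.
pose l := [seq p <- enum {: 'I_n * 'I_n} | weight p.1 p.2 (tt p) != weight u v (tt p)].
have op1E p Y u' v' : Ad Pd (op p Y) u' v' =
    (weight u' v' (tt p) - weight p.1 p.2 (tt p)) * Ad Pd Y u' v'.
  rewrite /op -scaleNr addrC Ad_Pd_linear (Ad_T_entry _ _ _ (htt p).1).
  by rewrite mulrBl mulNr addrC.
have opE (s : seq ('I_n * 'I_n)) (u' v' : 'I_n) : Ad Pd (foldr op X s) u' v' =
    (\prod_(p <- s) (weight u' v' (tt p) - weight p.1 p.2 (tt p))) * Ad Pd X u' v'.
  elim: s => [|p s IH] /=; first by rewrite big_nil mul1r.
  by rewrite big_cons op1E IH mulrA.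
pose X' := foldr op X l.
have X'uv : Ad Pd X' u v != 0.
  rewrite opE mulf_neq0 //; rewrite prodf_seq_neq0; apply/allP => p.
  by rewrite mem_filter => /andP[h _] /=; rewrite subr_eq0 eq_sym.
have X'0 : X' != 0.
  by apply: contraNneq X'uv => ->; rewrite /Ad mulmx0 mul0mx mxE.
have hX' : tangent Bp X'.
  rewrite /X'; elim: (l) => //= p s IH; apply: subspaceB => //.
  - exact: tangent_subspace.
  - have hT := (htt p).1; case: subgroup_Bp => _ _ hM hV.
    apply: tangent_conj IH; first exact: T_unit.
    by move=> g hg; apply: (hM); [apply: (hM) => //|apply: hV]; apply: T_Bp.
  - by apply: subspaceZ => //; apply: tangent_subspace.
have wX' t : T t -> Ad t X' = weight u v t *: X'.
  move=> hT; apply: Ad_Pd_inj => r w; rewrite Ad_T_entry // Ad_PdZ.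
  have [->|h] := eqVneq (Ad Pd X' r w) 0; first by rewrite !mulr0.
  congr (_ * _); case: (htt (r, w)).2 => [/(_ t hT) //|/= e].
  case/eqP: h; rewrite opE (big_rem (r, w)) /= ?subrr ?mul0r //.
  by rewrite mem_filter e mem_enum.
have v0 := eig_neq0 v t0_T.
have E m : weight u v t0 = 2 ^+ m -> eig t0 u = 2 ^+ m * eig t0 v.
  by move=> <-; rewrite /weight divfK.
case: (weight_root X'0 (tangent_lie hk hX') wX') => [h|[γ γroot γE]].
  by exists 0%N; apply: E; rewrite h.
have γG : is_root T GG γ.
  case: γroot => hc ht1 [Y [Y0 lY wY]]; split=> //; exists Y; split=> //.
  by apply: lieS lY => g; apply: Bp_G.
case: (pg_base G) => _ _ /(_ γ γG) [[_ [m hm]]|[]//].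
exists (\sum_i ht i * m i)%N; apply: E; rewrite -γE // hm //.
by rewrite expr_sum; apply: eq_bigr => i _; rewrite root_t0 exprM.
Qed.

(** The eigenvalues of [t0] which occur are [2 ^- m] with [m > 0] on the one
    hand, and [2 ^+ m'] on the other. *)
Lemma low_tangent_Bp X : low 1 X -> tangent Bp X -> X = 0.
Proof.
move=> hl hX; apply/eqP; apply: contraT => /Ad_Pd_neq0 [u [v Xuv]].
have [m m0 e] := hl _ _ Xuv; have [m' e'] := tangent_Bp_weight hX Xuv.
have v0 := eig_neq0 v t0_T.
have /eqP[] : 2 ^+ (m' + m) != 1 :> k by apply: pow2_neq1; rewrite addn_gt0 m0 orbT.
by apply: (mulIf v0); rewrite mul1r -[RHS]e e' exprD mulrAC.
Qed.

(** * Root vectors *)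

(** Conjugation by [refl_rep i] multiplies [t] by a value of the coroot, and so
    acts on weights as the simple reflection. *)
Lemma rchar_reflection (z : I -> int) i t : T t ->
  rchar z (coroot i (α i t)^-1 *m t) = rchar z t * α i t ^ (- \sum_j z j * a i j).
Proof.
move=> hT; have ai0 := pg_root_neq0 i hT.
have aV0 : (α i t)^-1 != 0 by rewrite invr_eq0.
have sumE (f : I -> int) : α i t ^ (\sum_j f j) = \prod_j α i t ^ f j.
  by apply: (big_morph (fun m => α i t ^ m)) => [m m'|//]; rewrite expfzDr.
rewrite -sumrN sumE /rchar -big_split; apply: eq_bigr => j _ /=.
rewrite pg_rootM ?coroot_root //; last exact: coroot_T.
by rewrite expfzMl mulrC exprz_exp exprz_inv [z j * _]mulrC.
Qed.

Lemma rchar_t0 (z : I -> int) : (forall j, 0 <= z j) ->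
  rchar (fun j => - z j) t0 = (2 ^+ (\sum_j ht j * `|z j|))^-1.
Proof.
move=> hz; rewrite expr_sum -prodfV; apply: eq_bigr => j _.
by rewrite -invr_expz root_t0 exprM -{1}(gez0_abs (hz j)).
Qed.

(** A simple reflection permutes the positive roots other than its own one, and
    it preserves [pminus i], whose only weights outside [nminus] are [0] and the
    simple root [i]. *)
Lemma root_vector (s : seq I) l : reduced a (rcons s l) -> exists X, [/\ X != 0, nminus X &
  forall t, T t -> Ad t X = rchar (fun j => - word_act a s (basisZ l) j) t *: X].
Proof.
elim: s => [|i s IH] hr.
  exists (cf l); split; [exact: cf_neq0|exact: cf_nminus|move=> t hT].
  rewrite Ad_T_f //; congr (_ *: _); rewrite /rchar (bigD1 l) //= big1 => [|j jl].
    by rewrite ffunE eqxx mulr1 -invr_expz expr1z.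
  by rewrite ffunE (negbTE jl) oppr0 expr0z.
have [X [X0 hX wX]] := IH (@reduced_catr _ _ [:: i] _ hr).
set β := word_act a s (basisZ l) in wX.
have pos := reduced_rcons_nonneg ha hr.
rewrite -[word_act a (i :: s) (basisZ l)]/(simple_refl a i β) in pos *.
set β' := simple_refl a i β in pos *.
pose X' := Ad (refl_rep i) X.
have wX' t : T t -> Ad t X' = rchar (fun j => - β' j) t *: X'.
  move=> hT; have hT' : T (coroot i (α i t)^-1 *m t).
    by apply: torus_mul => //; apply: coroot_T; rewrite invr_eq0 pg_root_neq0.
  rewrite /X' -AdM ?refl_rep_unit ?T_unit // T_refl_rep // AdM ?refl_rep_unit ?T_unit //.
  rewrite wX // AdZ; congr (_ *: _); rewrite rchar_reflection //.
  rewrite /rchar (bigD1 i) //= [RHS](bigD1 i) //= mulrAC; congr (_ * _).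
    rewrite -expfzDr ?pg_root_neq0 //; congr (_ ^ _).
    rewrite /β' simple_reflE eqxx mul1r opprB addrC; congr (_ + _).
    by rewrite -sumrN; apply: eq_bigr => j _; rewrite mulNr opprK.
  apply: eq_bigr => j ji; congr (_ ^ - _).
  by rewrite /β' simple_reflE eq_sym (negbTE ji) mul0r subr0.
have X'0 : X' != 0.
  by apply: contraNneq X0 => /(Ad_eq0 (refl_rep_unit i)) ->.
have pX' : pminus i X'.
  rewrite /X' /refl_rep !AdM ?unitmx_mul ?x_unit ?y_unit //.
  by apply/Ad_x_pminus/Ad_y_pminus/Ad_x_pminus/bminus_pminus/nminus_bminus.
exists X'; split=> //.
(* [op 1 \o op (α i t0)] kills the weights [0] and [i], so it maps [pminus i]
   into [nminus]; it multiplies [X'] by a nonzero scalar. *)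
pose op c Y := Ad t0 Y - c *: Y.
have op_lin c : linear (op c).
  by move=> d Y Z; rewrite /op Ad_linear; apply/matrixP => u v; rewrite !mxE; ring.
have op_nminus c Y : nminus Y -> nminus (op c Y).
  move=> hY; apply: subspaceB; first exact: span_subspace.
    exact: Ad_T_nminus.
  by apply: subspaceZ => //; apply: span_subspace.
have op0 c : op c 0 = 0 by rewrite /op /Ad mulmx0 mul0mx scaler0 subr0.
have nO : nminus (op 1 (op (α i t0) X')).
  move: pX'; apply: (@span_map _ _ _ _ _ _ _ (fun Y => op 1 (op (α i t0) Y))) => [||Y].
  - exact: span_subspace.
  - by move=> d Y Z; rewrite !op_lin.
  - case=> [[hY|[j ->]]|->].
    + by apply/op_nminus/op_nminus/span_in.
    + rewrite {2}/op Ad_T_h // -{1}[ch j]scale1r -scalerBl /op AdZ Ad_T_h //.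
      by rewrite scale1r subrr; apply: span0.
    + by rewrite {2}/op Ad_T_e // subrr op0; apply: span0.
set κ := rchar (fun j => - β' j) t0.
have E : op 1 (op (α i t0) X') = ((κ - 1) * (κ - α i t0)) *: X'.
  have -> : op (α i t0) X' = (κ - α i t0) *: X' by rewrite /op wX' // scalerBl.
  by rewrite /op AdZ wX' // scalerA scale1r -scalerBl; congr (_ *: _); rewrite /κ; ring.
have κ0 : (κ - 1) * (κ - α i t0) != 0.
  rewrite /κ rchar_t0 // root_t0; set m := (\sum_j _)%N.
  have m0 : (0 < m)%N.
    rewrite lt0n; apply: contraT; rewrite negbK sum_nat_eq0 => /forallP h.
    have b0 : β' = 0.
      apply: vecP => j; have := h j; rewrite /= muln_eq0 -leqn0 leqNgt ht_gt0 /=.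
      by rewrite absz_eq0 => /eqP ->; rewrite ffun0E.
    have := form_act_simple ha (i :: s) l; rewrite -[word_act a (i :: s) (basisZ l)]/β' b0.
    by rewrite /form big1 // => j _; rewrite big1 // => j' _; rewrite ffun0E !mul0r.
  have mm := pow2_neq0 m.
  rewrite mulf_neq0 // subr_eq0.
    by rewrite invr_eq1 pow2_neq1.
  have mi : (0 < m + ht i)%N by rewrite addn_gt0 m0.
  apply: contraNneq (pow2_neq1 mi) => e.
  by rewrite exprD -e divff.
move: nO; rewrite E => /(subspaceZ ((κ - 1) * (κ - α i t0))^-1 (span_subspace _)).
by rewrite scalerA mulVf // scale1r.
Qed.

(** * The coordinates of opposite flags *)

Definition xprod (s : seq (I * k)) : M := foldr (fun p g => x p.1 p.2 *m g) 1%:M s.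
Definition yprod (s : seq (I * k)) : M := foldr (fun p g => y p.1 p.2 *m g) 1%:M s.
Definition letter_sum i (s : seq (I * k)) : k := \sum_(p <- s | p.1 == i) p.2.

(** Generated by the conjugates under [y i] of the other [y j]; it is contained
    in the unipotent radical of a parabolic subgroup with Levi factor generated
    by [T], [x i] and [y i]. *)
Inductive radical i : M -> Prop :=
| radical1 : radical i 1%:M
| radical_cons e j d r : j != i -> radical i r ->
    radical i (Ad (y i e) (y j d) *m r).

Lemma radical_unit i r : radical i r -> r \in unitmx.
Proof.
elim=> [|e j d r' _ _ ur]; first exact: unitmx1.
by rewrite !unitmx_mul unitmx_inv !y_unit.
Qed.

Lemma radical_conj i b r : radical i r -> radical i (Ad (y i b) r).
Proof.
elim=> [|e j d r' ji _ IH].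
  by rewrite /Ad mulmx1 mulmxV ?y_unit //; apply: radical1.
rewrite Ad_mul ?y_unit // -AdM ?y_unit // -y_add.
exact: radical_cons.
Qed.

(** Move the factors [y i] to the right. *)
Lemma yprod_radical i (s : seq (I * k)) : exists2 r, radical i r & yprod s = r *m y i (letter_sum i s).
Proof.
elim: s => [|[j b] s [r hr e]].
  by exists 1%:M; [apply: radical1|rewrite /letter_sum big_nil y_zero mulmx1].
rewrite /= e /letter_sum big_cons /=; have [->|ji] := eqVneq j i.
  exists (Ad (y i b) r); first exact: radical_conj.
  by rewrite y_add /Ad !mulmxA mulmxKV // y_unit.
exists (Ad (y i 0) (y j b) *m r); first exact: radical_cons.
by rewrite y_zero Ad1 mulmxA.
Qed.

(** For generic [e], reorder [x i c *m y i e] in the big cell; its factor [x i]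
    commutes with [y j d]. *)
Lemma low_Ad_x_y i j c e d : j != i -> low 0 (Ad (x i c) (Ad (y i e) (y j d))).
Proof.
move=> ji.
pose Z := mxconst (x i c) *m yp i *m mxconst (y j d) *m mxscale (-1) (yp i) *m mxconst (x i (- c)).
have ZE b : mxeval Z b = Ad (x i c) (Ad (y i b) (y j d)).
  rewrite !mxevalM !mxeval_const mxeval_scale -!ypE mulN1r.
  by rewrite /Ad x_inv y_inv !mulmxA.
rewrite -ZE; apply: (subspace_value hk); first exact: low_subspace.
apply: genericS (generic_affine c (oner_neq0 k)) => b s0.
have cT := coroot_T i s0.
rewrite ZE -AdM ?x_unit ?y_unit // x_y_swap // AdM ?x_unit //; last first.
  by rewrite unitmx_mul y_unit T_unit.
have -> : Ad (x i (c / (1 + c * b))) (y j d) = y j d.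
  by rewrite /Ad x_y_comm 1?eq_sym // mulmxK // x_unit.
have [h h'] : low 0 (y i (b / (1 + c * b)) *m coroot i (1 + c * b)) /\
    low 0 (invmx (y i (b / (1 + c * b)) *m coroot i (1 + c * b))).
  apply: lower_low; apply: lower_y; rewrite -[coroot _ _]mulmx1.
  by apply: lower_T => //; apply: lower1.
by apply: low_Ad => //; apply: low_y.
Qed.

Lemma radical_low i c r : radical i r ->
  low 0 (Ad (x i c) r) /\ low 0 (Ad (x i c) (invmx r)).
Proof.
elim=> [|e j d r' ji hr [h h']].
  by rewrite invmx1 /Ad mulmx1 mulmxV ?x_unit //; split; apply: low_T; apply: torus_one.
have uA : Ad (y i e) (y j d) \in unitmx by rewrite !unitmx_mul unitmx_inv !y_unit.
rewrite (invmxM uA (radical_unit hr)).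
have -> : invmx (Ad (y i e) (y j d)) = Ad (y i e) (y j (- d)).
  by rewrite /Ad !invmxM ?unitmx_mul ?unitmx_inv ?y_unit // !y_inv opprK mulmxA.
have A := @low_Ad_x_y i j c e d ji; have A' := @low_Ad_x_y i j c e (- d) ji.
by split; rewrite (Ad_mul _ _ (x_unit i c)); [exact: low0M A h|exact: low0M h' A'].
Qed.

Lemma Ad_xprod (s : seq (I * k)) X : Ad (xprod s) X = foldr (fun p X => Ad (x p.1 p.2) X) X s.
Proof.
elim: s => [|p s IH] /=; first exact: Ad1.
rewrite AdM ?x_unit ?IH //.
by elim: (s) => [|q s' u] /=; rewrite ?unitmx1 // unitmx_mul x_unit.
Qed.

Lemma xprod_unit (s : seq (I * k)) : xprod s \in unitmx.
Proof. by elim: s => [|q s' u] /=; rewrite ?unitmx1 // unitmx_mul x_unit. Qed.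

(** Independence holds because the weights of the root vectors are distinct, by
    [inversions_neq]. *)
Lemma root_vectors (w : seq I) : reduced a w ->
  exists X : 'I_(size w) -> M, (forall o, nminus (X o)) /\
  forall c : 'I_(size w) -> k, (exists o, c o != 0) -> \sum_o c o *: X o != 0.
Proof.
move=> rw; case: w rw => [|i0 w'] rw.
  by exists (fun=> 0); split=> [[]//|c [[]]].
set w := i0 :: w' in rw *.
pose β (o : 'I_(size w)) := word_act a (take o w) (basisZ (nth i0 w o)).
have ro (o : 'I_(size w)) : reduced a (rcons (take o w) (nth i0 w o)).
  rewrite -take_nth //; apply: (@reduced_catl _ _ _ (drop o.+1 w)).
  by rewrite cat_take_drop.
have [X hX] := fin_all_exists (fun o => root_vector (ro o)).
exists X; split=> [o|c [o co]]; first by case: (hX o).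
have [X0 _ wX] := hX o; have [u [v Xuv]] := Ad_Pd_neq0 X0.
have lt (o1 o2 : 'I_(size w)) : (o1 < o2)%N -> β o1 <> β o2.
  move=> o12; have E : take o2 w = take o1 w ++ nth i0 w o1 :: drop o1.+1 (take o2 w).
    rewrite -{1}[take o2 w](cat_take_drop o1) take_takel 1?ltnW //; congr (_ ++ _).
    rewrite (drop_nth i0) ?nth_take // size_takel // ltnW //; exact: ltn_ord.
  by have h := ro o2; rewrite E in h; have := inversions_neq ha h; rewrite /β {2}E.
have other o' : o' != o -> Ad Pd (X o') u v = 0.
  move=> oo'; apply/eqP; apply: contraT => e.
  have [_ _ wX'] := hX o'.
  have E : β o = β o'.
    apply: vecP => j; apply: oppr_inj; move: j; apply: rchar_inj => t hT.
    by rewrite (weight_eq hT (wX t hT) Xuv) (weight_eq hT (wX' t hT) e).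
  by case: (ltngtP o o') oo' => [/lt|/lt/(_ (esym E))|/ord_inj ->] //; rewrite eqxx.
apply: contraNneq co => S0; have : Ad Pd (\sum_o c o *: X o) u v = 0.
  by rewrite S0 /Ad mulmx0 mul0mx mxE.
rewrite (bigD1 o) //= Ad_Pd_linear.
have -> : Ad Pd (\sum_(o' | o' != o) c o' *: X o') u v = 0.
  elim/big_rec: _ => [|o' Y oo' h]; first by rewrite /Ad mulmx0 mul0mx mxE.
  by rewrite Ad_Pd_linear h other // mulr0 add0r.
by rewrite addr0 => /eqP; rewrite mulf_eq0 (negbTE Xuv) orbF.
Qed.

(** If [t * letter_sum i s' != 1], then a lower triangular element [R *m L]
    conjugates to [Bp] the conjugate of [Bm] by the inverse of [xprod s]. But [xprod s] has
    fewer factors than there are root vectors, so [Ad (xprod s)] sends some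
    nonzero [Y] of [nminus] to a vector tangent to [Bm], and [Ad (R *m L) Y] is
    both strictly lower triangular and tangent to [Bp]. *)
Lemma last_coordinate (s s' : seq (I * k)) i (t : k) :
  reduced a (rcons (map fst s) i) ->
  (forall g, Bm g -> let q := yprod s' *m invmx (xprod (rcons s (i, t))) in
     Bp (q *m g *m invmx q)) ->
  t * letter_sum i s' = 1.
Proof.
move=> rw hq; set χ := letter_sum i s'.
have [//|t1] := eqVneq (t * χ) 1.
have [X [nX indX]] := root_vectors rw.
have hop p : exists e, forall X, bminus X -> exists Y c, bminus Y /\
    Ad (x p.1 p.2) X = Y + c *: e.
  by exists (ce p.1) => Y hY; apply: Ad_x_bminus.
have ss : (size s < size (rcons (map fst s) i))%N by rewrite size_rcons size_map.
have [c c0 hc] := elimination (span_subspace _) (fun p : I * k => Ad_linear _) hop ss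
  (fun o => nminus_bminus (nX o)).
set Y := \sum_o _ in hc; have Y0 : Y != 0 by apply: indX.
have nY : nminus Y.
  have hS := @span_subspace k n n nminus_gen.
  by apply: (subspace_sum _ hS) => o; apply: (subspaceZ _ hS); apply: nX.
rewrite -Ad_xprod in hc; have := bminus_tangent hc => tY.
have ux := xprod_unit s; have [r hr yE] := yprod_radical i s'.
have xr : xprod (rcons s (i, t)) = xprod s *m x i t.
  elim: (s) => [|p s1 IH] /=; first by rewrite mul1mx mulmx1.
  by rewrite IH mulmxA.
have s0 : 1 + (- t) * χ != 0.
  by apply: contraNneq t1; rewrite mulNr => /eqP; rewrite subr_eq0 eq_sym => /eqP ->.
set q := yprod s' *m invmx (xprod (rcons s (i, t))) in hq.
pose σ := (1 + (- t) * χ)^-1.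
pose L := coroot i σ *m y i (χ * σ).
pose R := Ad (x i (- (- t * σ))) r.
have σ0 : σ != 0 by rewrite invr_eq0.
have qx : q *m xprod s = x i (- t * σ) *m (R *m L).
  rewrite /q xr invmxM ?x_unit // x_inv yE -!mulmxA mulVmx // mulmx1.
  rewrite y_x_swap // -/σ /R /L /Ad !mulmxA -x_add subrr x_zero mul1mx.
  by rewrite x_inv opprK -!mulmxA.
have uq : q \in unitmx.
  rewrite unitmx_mul unitmx_inv xprod_unit andbT yE unitmx_mul y_unit andbT.
  exact: radical_unit hr.
have hL : lower_group L.
  apply: lower_T; first exact: coroot_T.
  by rewrite -[y i _]mulmx1; apply: lower_y; apply: lower1.
have [R1 R2] := radical_low (- (- t * σ)) hr.
have uR : R \in unitmx.
  by rewrite !unitmx_mul unitmx_inv !x_unit (radical_unit hr).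
have RV : invmx R = Ad (x i (- (- t * σ))) (invmx r).
  rewrite /R /Ad !invmxM ?unitmx_mul ?unitmx_inv ?x_unit ?(radical_unit hr) //.
  by rewrite !x_inv opprK mulmxA.
have uRL : R *m L \in unitmx by rewrite unitmx_mul uR (lower_unit hL).
have tW : tangent Bp (Ad (R *m L) Y).
  have -> : Ad (R *m L) Y = Ad (x i (- (- t * σ))) (Ad q (Ad (xprod s) Y)).
    rewrite -(AdM Y uq ux) qx -AdM ?x_unit //; last first.
      by rewrite unitmx_mul x_unit.
    by rewrite mulmxA -x_add addNr x_zero mul1mx.
  have tQ := tangent_conj uq hq tY.
  case: subgroup_Bp => _ _ hM hV; apply: tangent_conj tQ; first exact: x_unit.
  by move=> g hg; apply: (hM); [apply: (hM) => //; exact: x_Bp|apply: hV; exact: x_Bp].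
have lW : low 1 (Ad (R *m L) Y).
  have [L1 L2] := lower_low hL.
  rewrite (AdM _ uR (lower_unit hL)); apply: low_Ad => //; first by rewrite RV.
  by apply: low_Ad => //; apply: nminus_low.
by case/eqP: Y0; apply: (Ad_eq0 uRL); apply: low_tangent_Bp.
Qed.

End Grading.
End Weights.
End Generators.
End Pinned.

(** * Coroot velocities and a dominant element of the torus *)

Section Existence.
Variables (k : closedFieldType) (I : finType) (a : I -> I -> int).
Hypotheses (hk : [pchar k] =i pred0) (ha : cartan a).
Variable G : pinned_group k a.

Local Notation n := (pg_dim G).
Local Notation M := 'M[k]_n.

Lemma jet_mx2 (s : k -> k) b (l : 'I_((1 + 1) * (1 + 1))) : jet s 1 b ->
  jet (fun c => mxvec (mx2 (s c) 0 0 (s c)^-1) 0 l)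
    (mxvec (mx2 1 0 0 1 : 'M[k]_(1 + 1)) 0 l)
    (b * mxvec (mx2 1 0 0 (-1) : 'M[k]_(1 + 1)) 0 l).
Proof.
move=> js; have jV := jetV (oner_neq0 _) js; rewrite invr1 expr1n divr1 in jV.
case/mxvec_indexP: l => i j; rewrite !mxvecE.
have E (p q r t : k) : mx2 p q r t i j =
    if i == 0 then if j == 0 then p else q else if j == 0 then r else t.
  by rewrite /mx2 !mxE; case: (split_ordP i) => i' ->; rewrite !mxE;
     case: (split_ordP j) => j' ->; rewrite !mxE !ord1 -!val_eqE.
apply: (@jet_eq _ (fun c => if i == 0 then if j == 0 then s c else 0
    else if j == 0 then 0 else (s c)^-1)); first by apply: generic_all => c; rewrite mxvecE E.
rewrite !E; case: (i == 0); case: (j == 0); rewrite ?mulr1 ?mulr0 ?mulrN1 //; exact: jet_cst.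
Qed.

Lemma coroot_velocity i : exists H : M, forall (s : k -> k) b, jet s 1 b ->
  mjet (fun c => coroot G i (s c)) 1%:M (b *: H).
Proof.
have [_ _ reg] := pg_sl2_hom G i.
have reg' (p : 'I_n * 'I_n) : exists P : {mpoly k[(1 + 1) * (1 + 1)]},
    forall g : 'M[k]_(1 + 1), \det g = 1 -> pg_sl2 G i g p.1 p.2 = P.@[mxvec g 0].
  have [P [m h]] := reg p.1 p.2; exists P => g hg.
  by rewrite h // hg expr1n divr1.
have [P hP] := fin_all_exists reg'.
pose E : 'M[k]_(1 + 1) := mx2 1 0 0 1.
exists (\matrix_(u, v) \sum_l mxvec (mx2 1 0 0 (-1) : 'M[k]_(1 + 1)) 0 l *
  (P (u, v))^`M(l).@[mxvec E 0]) => s b js u v.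
have detE : \det E = 1 by rewrite det_mx2u mulr1.
have -> : (1%:M : M) u v = (P (u, v)).@[mxvec E 0].
  by rewrite -(hP (u, v)) // pg_sl2x x_zero.
rewrite !mxE mulr_sumr; under eq_bigr => l _ do rewrite mulrA.
apply: jet_eq (jet_meval (P (u, v)) (Γ := fun c => mxvec (mx2 (s c) 0 0 (s c)^-1) 0)
  (fun l => jet_mx2 l js)).
apply: genericS (jet_neq0 (oner_neq0 _) js) => c s0.
by rewrite -(hP (u, v)) // det_mx2u divff.
Qed.

(** [a] is invertible over the rationals, so some integral combination of
    coroots pairs with all the simple roots to the same positive integer. *)
Lemma dominant_coweight : exists (m : I -> int) (d : nat), (0 < d)%N /\
  forall j, \sum_i m i * a i j = d.
Proof.
pose r := #|I|.
pose A : 'M[int]_r := \matrix_(u, v) a (enum_val u) (enum_val v).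
have sumI (f : I -> int) : \sum_i f i = \sum_(u < r) f (enum_val u).
  by rewrite (big_enum_val f).
have detA : \det A != 0.
  apply/negP => /det0P [v v0 vA].
  pose z : {ffun I -> int} := [ffun i => v 0 (enum_rank i)].
  have z0 : z != 0.
    apply: contraNneq v0 => z0; apply/eqP/rowP => u; rewrite mxE.
    by have := ffunE (fun i => v 0 (enum_rank i)) (enum_val u); rewrite -/z z0 ffunE enum_valK.
  have := form_gt0 ha z0; suff -> : form a z z = 0 by rewrite ltxx.
  rewrite /form exchange_big big1 // => j _; rewrite -mulr_suml.
  have -> : \sum_i z i * a i j = (v *m A) 0 (enum_rank j).
    rewrite mxE sumI; apply: eq_bigr => u _.
    by rewrite /z ffunE enum_valK mxE enum_rankK.
  by rewrite vA mxE mul0r.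
pose w : 'rV[int]_r := \det A *: (const_mx 1 *m \adj A).
have wA j : (w *m A) 0 j = \det A * \det A.
  rewrite /w -scalemxAl -mulmxA mul_adj_mx mul_mx_scalar mxE mxE.
  by rewrite !mxE mulr1.
exists (fun i => w 0 (enum_rank i)), (`|\det A| * `|\det A|)%N; split.
  by rewrite muln_gt0 absz_gt0 detA.
move=> j; rewrite sumI.
transitivity ((w *m A) 0 (enum_rank j)).
  by rewrite [RHS]mxE; apply: eq_bigr => u _; rewrite enum_valK [A _ _]mxE enum_rankK.
by rewrite wA PoszM !abszE -normrM -expr2 ger0_norm ?sqr_ge0.
Qed.

Lemma dominant_element : exists (t0 : M) (d : nat),
  [/\ pg_T t0, (0 < d)%N & forall j, pg_root j t0 = 2 ^+ d].
Proof.
have [m [d [d0 hd]]] := dominant_coweight.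
have two0 : 2 != 0 :> k by rewrite ((pcharf0P k).1 hk).
pose h i := coroot G i (2 ^ m i).
have hT i : pg_T (h i) by apply: coroot_T; rewrite expfz_neq0.
have [t [tT tr]] : exists t : M, pg_T t /\
    forall j, pg_root j t = 2 ^ (\sum_(i <- enum I) m i * a i j).
  elim: (enum I) => [|i s [t [tT tr]]].
    by exists 1%:M; split=> [|j]; [apply: torus_one|rewrite big_nil expr0z pg_root1].
  exists (h i *m t); split=> [|j]; first exact: torus_mul.
  rewrite big_cons pg_rootM // tr coroot_root ?expfz_neq0 //.
  by rewrite expfzDr // exprz_exp.
exists t, d; split=> // j; rewrite tr.
have -> : \sum_(i <- enum I) m i * a i j = d by rewrite big_enum hd.
by [].
Qed.

(** The data for [last_coordinate] exist: the root homomorphisms are polynomial,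
    the coroots are regular, [T] is diagonalizable, and [dominant_element] gives
    the grading. *)
Theorem opposite_flags (s s' : seq (I * k)) i (t : k) :
  reduced a (rcons (map fst s) i) ->
  (forall g, conj_set (@pg_Bm _ _ _ G) (xprod G (rcons s (i, t))) g <->
             conj_set (@pg_Bp _ _ _ G) (yprod G s') g) ->
  t * letter_sum i s' = 1.
Proof.
move=> rw hq.
have hx j : exists Z : 'M[{poly k}]_n, forall c, pg_x G j c = mxeval Z c.
  have [[Z hZ] _ _ _ _] := pg_xroot G j.
  by exists Z => c; apply/matrixP => u v; rewrite hZ mxE.
have [xp hxp] := fin_all_exists hx.
have hy j : exists Z : 'M[{poly k}]_n, forall c, pg_y G j c = mxeval Z c.
  have [[Z hZ] _ _ _ _] := pg_yroot G j.
  by exists Z => c; apply/matrixP => u v; rewrite hZ mxE.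
have [yp hyp] := fin_all_exists hy.
have [ch hch] := fin_all_exists coroot_velocity.
have [[_ _ [Pd Pu Pdiag]] _ _] := pg_torus G.
have [t0 [d [t0T d0 rt0]]] := dominant_element.
apply: (@last_coordinate _ _ _ hk ha G xp yp ch hxp hyp hch Pd Pu Pdiag t0 (fun=> d)
  t0T (fun=> d0) rt0 s s' i t rw) => g hg q.
have ux := xprod_unit G (rcons s (i, t)).
set u := xprod G (rcons s (i, t)) in hq q ux *; set v := yprod G s' in hq q *.
have uv : v \in unitmx.
  by rewrite /v; elim: (s') => [|p s1 IH] /=; rewrite ?unitmx1 // unitmx_mul y_unit.
have /hq : conj_set (@pg_Bm _ _ _ G) u (invmx u *m g *m u).
  by rewrite /conj_set !mulmxA mulmxV // mul1mx mulmxK.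
rewrite /conj_set /q invmxM ?unitmx_inv // invmxK !mulmxA.
by [].
Qed.

End Existence.

(** * Positive rational numbers *)

Definition posrat := {q : rat | 0 < q}.

Definition pr_add (u v : posrat) : posrat := exist _ (val u + val v) (addr_gt0 (valP u) (valP v)).
Definition pr_mul (u v : posrat) : posrat := exist _ (val u * val v) (mulr_gt0 (valP u) (valP v)).
Definition pr_one : posrat := exist _ 1 (@ltr01 rat).
Lemma pr_inv_subproof (u : posrat) : 0 < (val u)^-1. Proof. by rewrite invr_gt0 (valP u). Qed.
Definition pr_inv (u : posrat) : posrat := exist _ (val u)^-1 (pr_inv_subproof u).

Lemma pr_addA : associative pr_add. Proof. by move=> u v w; apply: val_inj; apply: addrA. Qed.
Lemma pr_addC : commutative pr_add. Proof. by move=> u v; apply: val_inj; apply: addrC. Qed.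
Lemma pr_mulA : associative pr_mul. Proof. by move=> u v w; apply: val_inj; apply: mulrA. Qed.
Lemma pr_mulC : commutative pr_mul. Proof. by move=> u v; apply: val_inj; apply: mulrC. Qed.
Lemma pr_mul1 : left_id pr_one pr_mul. Proof. by move=> u; apply: val_inj; apply: mul1r. Qed.
Lemma pr_mulV : left_inverse pr_one pr_inv pr_mul.
Proof. by move=> u; apply: val_inj; apply: mulVf; rewrite gt_eqF // (valP u). Qed.
Lemma pr_mulDl : left_distributive pr_mul pr_add.
Proof. by move=> u v w; apply: val_inj; apply: mulrDl. Qed.

Definition Qpos : semifield := @Semifield posrat pr_add pr_mul pr_one pr_inv
  pr_addA pr_addC pr_mulA pr_mulC pr_mul1 pr_mulV pr_mulDl.

Section Ratr.
Variable F : fieldType.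
Hypothesis hF : [pchar F] =i pred0.

Lemma intr_eq0_char0 (z : int) : (z%:~R == 0 :> F) = (z == 0).
Proof.
have h := (pcharf0P F).1 hF.
by case: z => m; rewrite ?NegzE ?mulrNz ?oppr_eq0; [apply: h|apply: h].
Qed.

Lemma ratr_frac (z d : int) : d != 0 -> ratr (z%:Q / d%:Q) = z%:~R / d%:~R :> F.
Proof.
move=> d0; set q := z%:Q / d%:Q.
have q0 : denq q != 0 by rewrite denq_neq0.
have E : numq q * d = z * denq q.
  apply: (@intr_inj rat); rewrite !intrM.
  have dq0 : d%:Q != 0 by rewrite intr_eq0.
  have -> : z%:Q = q * d%:Q by rewrite /q divfK.
  by rewrite numqE mulrAC.
have E' : (numq q)%:~R * d%:~R = z%:~R * (denq q)%:~R :> F by rewrite -!intrM E.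
rewrite /ratr; apply/eqP; rewrite eqr_div ?intr_eq0_char0 //; exact/eqP.
Qed.

Lemma ratrM (q r : rat) : ratr (q * r) = ratr q * ratr r :> F.
Proof.
have q0 := denq_neq0 q; have r0 := denq_neq0 r.
rewrite -{1}(divq_num_den q) -{1}(divq_num_den r) mulrACA -invfM -!intrM.
by rewrite ratr_frac ?mulf_neq0 // /ratr !intrM invfM mulrACA.
Qed.

Lemma ratrD (q r : rat) : ratr (q + r) = ratr q + ratr r :> F.
Proof.
have q0 := denq_neq0 q; have r0 := denq_neq0 r.
rewrite -{1}(divq_num_den q) -{1}(divq_num_den r) addf_div ?intr_eq0 //.
rewrite -!intrM -intrD ratr_frac ?mulf_neq0 // /ratr addf_div ?intr_eq0_char0 //.
by rewrite intrD !intrM.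
Qed.

Lemma ratr_eq0 (q : rat) : (ratr q == 0 :> F) = (q == 0).
Proof.
by rewrite /ratr mulf_eq0 invr_eq0 !intr_eq0_char0 (negbTE (denq_neq0 q)) orbF numq_eq0.
Qed.

Lemma ratr1 : ratr 1 = 1 :> F.
Proof. by have := @ratr_frac 1 1 isT; rewrite !divr1. Qed.

Lemma ratr_inj : injective (ratr : rat -> F).
Proof.
move=> q r e; apply/eqP; rewrite -subr_eq0 -ratr_eq0 ratrD.
have -> : - r = (-1) * r by rewrite mulN1r.
have N1 : ratr (-1) = -1 :> F by have := @ratr_frac (-1) 1 isT; rewrite !divr1 !mulrN1z.
by rewrite ratrM N1 mulN1r e subrr.
Qed.

Definition pr_embed (u : Qpos) : F := ratr (val (u : posrat)).

Lemma pr_embedP : sf_embedding pr_embed.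
Proof.
split=> [u v /ratr_inj /val_inj //|u|u v|u v].
- by rewrite ratr_eq0 gt_eqF // (valP u).
- exact: ratrD.
- exact: ratrM.
Qed.

End Ratr.

(** * Growth of subtraction-free expressions *)

Section Growth.
Variable N : nat.
Hypothesis N1 : (1 <= N)%N.

Lemma powN_gt0 (t : int) : 0 < (N%:R : rat) ^ (- t).
Proof. by apply: exprz_gt0; rewrite ltr0n. Qed.

Definition powN (t : tropZ) : Qpos := exist _ ((N%:R : rat) ^ (- (t : int))) (powN_gt0 t).

Lemma powN_mul (t u : tropZ) : powN (smul t u) = smul (powN t) (powN u).
Proof. by apply: val_inj => /=; rewrite opprD expfzDr // pnatr_eq0 -lt0n. Qed.

Lemma powN_one : powN sone = sone.
Proof. by apply: val_inj; rewrite /= oppr0 expr0z. Qed.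

Variable n : nat.

Definition terms (K : semifield) (v : 'I_n -> K) (P : {mpoly int[n]}) : seq K :=
  flatten [seq nseq `|P@_m|%N (smonom v m) | m <- msupp P].

Lemma terms_neq0 (K : semifield) (v : 'I_n -> K) P : P != 0 -> terms v P <> [::].
Proof.
move=> P0; have : msupp P != [::] by rewrite msupp_eq0.
case E : (msupp P) => [//|m s] _; rewrite /terms E /=.
have : m \in msupp P by rewrite E mem_head.
by rewrite mcoeff_msupp -absz_gt0; case: `|_|%N.
Qed.

Lemma nqeval_ext (K : semifield) (v v' : 'I_n -> K) (f : nquot n) :
  v =1 v' -> nqeval v f = nqeval v' f.
Proof.
move=> e; have em m : smonom v m = smonom v' m by apply: eq_bigr => l _; rewrite e.
have es P : speval v P = speval v' P.
  by congr ssum; congr flatten; apply: eq_map => m; rewrite em.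
by rewrite /nqeval !es.
Qed.

Lemma smonom_powN (v : 'I_n -> tropZ) m : smonom (powN \o v) m = powN (smonom v m).
Proof.
rewrite /smonom (big_morph powN powN_mul powN_one); apply: eq_bigr => l _ /=.
by elim: (m l) => [|r IH] /=; rewrite ?powN_one // powN_mul IH.
Qed.

Lemma terms_powN (v : 'I_n -> tropZ) P : terms (powN \o v) P = map powN (terms v P).
Proof.
rewrite /terms map_flatten -map_comp; congr flatten; apply: eq_map => m /=.
by rewrite map_nseq smonom_powN.
Qed.

Lemma ssum_trop (s : seq tropZ) : s <> [::] ->
  (ssum s : int) \in (s : seq int) /\
  forall u : int, u \in (s : seq int) -> (ssum s : int) <= u.
Proof.
case: s => // t s _; rewrite /ssum; elim/last_ind: s => [|s u [IH1 IH2]].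
  by rewrite mem_head; split=> // u; rewrite inE => /eqP ->.
rewrite foldl_rcons -rcons_cons; set w : int := foldl _ _ s in IH1 IH2 *.
split=> [|r].
  rewrite mem_rcons inE [sadd _ _]/(Num.min w (u : int)) /Num.min.
  by case: ifP; rewrite ?IH1 ?orbT ?eqxx.
rewrite mem_rcons inE ge_min => /predU1P [->|/IH2 ->]; by rewrite ?lexx ?orbT.
Qed.

Lemma ssum_Qpos (s : seq Qpos) : s <> [::] ->
  val (ssum s : posrat) = \sum_(u <- s) val (u : posrat).
Proof.
case: s => // t s _; rewrite /ssum big_cons.
elim/last_ind: s => [|s u IH]; first by rewrite big_nil addr0.
by rewrite foldl_rcons /= IH -cats1 big_cat big_seq1 addrA.
Qed.

Lemma powN_mono (t u : int) : t <= u -> (N%:R : rat) ^ (- u) <= (N%:R : rat) ^ (- t).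
Proof. by move=> tu; apply: ler_weXz2l; rewrite ?ler1n ?lerN2. Qed.

Lemma sum_le_size (s : seq int) (f : int -> rat) c : {in s, forall u, f u <= c} ->
  \sum_(u <- s) f u <= (size s)%:R * c.
Proof.
elim: s => [|t s IH] h; first by rewrite big_nil mul0r.
rewrite big_cons /= -natr1 mulrDl mul1r addrC lerD //.
  by apply: IH => u us; apply: h; rewrite inE us orbT.
by apply: h; rewrite mem_head.
Qed.

(** The smallest exponent gives the dominant term. *)
Lemma speval_growth (v : 'I_n -> tropZ) P : P != 0 ->
  (N%:R : rat) ^ (- (speval v P : int)) <= val (speval (powN \o v) P : posrat) /\
  val (speval (powN \o v) P : posrat) <=
    (size (terms v P))%:R * (N%:R : rat) ^ (- (speval v P : int)).
Proof.
move=> P0; have T0 := @terms_neq0 _ v P P0.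
have [tin tmin] := ssum_trop T0.
have -> : val (speval (powN \o v) P : posrat) =
    \sum_(u <- (terms v P : seq int)) (N%:R : rat) ^ (- u).
  rewrite -[speval _ _]/(ssum (terms (powN \o v) P)) terms_powN ssum_Qpos ?big_map //.
  by case: (terms v P) T0.
rewrite -[speval v P]/(ssum (terms v P)); split.
  rewrite (big_rem _ tin) /= lerDl; apply: sumr_ge0 => u _.
  exact/ltW/powN_gt0.
by apply: sum_le_size => u /tmin; apply: powN_mono.
Qed.

Lemma nqeval_growth (v : 'I_n -> tropZ) (f : nquot n) :
  val (nqeval (powN \o v) f : posrat) <=
    (size (terms v (nq_num f)))%:R * (N%:R : rat) ^ (- (nqeval v f : int)).
Proof.
have [_ num] := speval_growth v (nq_num_neq0 f).
have [den _] := speval_growth v (nq_den_neq0 f).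
rewrite /nqeval /sdiv /=; set d : rat := val (speval (powN \o v) (nq_den f) : posrat) in den *.
have d0 : 0 < d by apply: lt_le_trans den; apply: powN_gt0.
rewrite ler_pdivrMr //; apply: le_trans num _.
set tn : int := speval v (nq_num f); set td : int := speval v (nq_den f) in den *.
have -> : (N%:R : rat) ^ (- tn) = N%:R ^ (- (tn - td)) * N%:R ^ (- td).
  by rewrite -expfzDr ?pnatr_eq0 -?lt0n //; congr (_ ^ _); ring.
rewrite mulrA; apply: ler_wpM2l den.
by rewrite mulr_ge0 ?ler0n // ltW // powN_gt0.
Qed.

End Growth.

(** * Comparison with the tropical semifield *)

Section Conclusion.
Variables (I : finType) (a : I -> I -> int) (ha : cartan a).
Variables (w0 : {ffun I -> int} -> {ffun I -> int}) (nu : nat).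
Hypothesis hw0 : longest a w0 nu.

Lemma equiv_word (K : semifield) (x y : pt I nu K) :
  pt_equiv a w0 x y -> is_word a w0 x.1 <-> is_word a w0 y.1.
Proof.
elim=> [u v []|u|u v _ []|u v w _ [] ? ? _ [] ? ?]; split; auto.
Qed.

Lemma UK_word (K : semifield) (A : UK a nu w0 K) x : A x -> is_word a w0 x.1.
Proof.
by have [x0 wx hx] := UK_class A; move=> /hx /equiv_word [h _]; apply: h.
Qed.

Lemma UK_equiv (K : semifield) (A : UK a nu w0 K) x y : A x -> pt_equiv a w0 x y -> A y.
Proof.
by have [x0 wx hx] := UK_class A; move=> /hx h1 h2; apply/hx; apply: rst_trans h1 h2.
Qed.

Lemma UK_related (K : semifield) (A : UK a nu w0 K) x y : A x -> A y -> pt_equiv a w0 x y.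
Proof.
have [x0 wx hx] := UK_class A; move=> /hx h1 /hx h2.
by apply: rst_trans h2; apply: rst_sym.
Qed.

Lemma UK_exists (K : semifield) (x : pt I nu K) : is_word a w0 x.1 ->
  exists A : UK a nu w0 K, A x.
Proof.
move=> wx; have h : exists2 z : pt I nu K, is_word a w0 z.1 &
    forall y, pt_equiv a w0 x y <-> pt_equiv a w0 z y by exists x.
by exists (MkUK h); apply: rst_refl.
Qed.

Variables (k : closedFieldType) (hk : [pchar k] =i pred0) (G : pinned_group k a).

Lemma pt_prodE (K : semifield) (ι : K -> k) (z : I -> k -> 'M[k]_(pg_dim G)) (x : pt I nu K) :
  pt_prod ι z x = foldr (fun p g => z p.1 p.2 *m g) 1%:M
    [seq (tnth x.1 o, ι (tnth x.2 o)) | o <- enum 'I_nu].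
Proof.
rewrite /pt_prod enumT; unlock index_enum.
by elim: (Finite.enum _) => [|o s IH]; rewrite ?big_nil // big_cons IH.
Qed.

(** [opposite_flags] in coordinates; the embedding of the positive rationals is
    injective, so its conclusion holds in the rationals. *)
Lemma inverse_coordinate i (w : nu.-tuple I) (z : seq I) (v v' : nu.-tuple Qpos)
    (phi0 : UK a nu w0 Qpos -> UK a nu w0 Qpos) (A : UK a nu w0 Qpos) :
  w = rcons z i :> seq I -> is_phi0 G (@pr_embed k) phi0 ->
  A (w, v) -> phi0 A (w, v') ->
  exists o : 'I_nu, (val (tnth v o : posrat) : rat) *
    \sum_(o' | tnth w o' == i) val (tnth v' o' : posrat) = 1.
Proof.
move=> ez [_ hphi] Av Av'; have ww := UK_word Av.
have := hphi A _ _ Av Av'; rewrite !pt_prodE /=.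
set s := map _ _; set s' := map _ _.
have s1 : map fst s = w by rewrite /s -map_comp map_tnth_enum.
case/lastP E : s s1 => [|s0 [j t]]; first by rewrite ez; case: (z).
rewrite map_rcons ez /= => /rcons_inj [s0z ji] flags; subst j.
have : (i, t) \in s by rewrite E mem_rcons mem_head.
case/mapP => o _ [_ et]; exists o; apply: (ratr_inj hk).
have rw : reduced a (rcons (map fst s0) i).
  by rewrite s0z -ez; apply: (longest_reduced hw0 ww); rewrite size_tuple.
rewrite (ratrM hk) (ratr1 hk) -[ratr (val _)]/(pr_embed k (tnth v o)) -et.
rewrite -(opposite_flags hk ha rw flags); congr (_ * _).
rewrite /letter_sum /s' big_map big_enum_cond /=.
by rewrite (big_morph (ratr : rat -> k) (ratrD hk) (id1 := 0)) //; apply/eqP; rewrite (ratr_eq0 hk).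
Qed.

End Conclusion.

Theorem mainTheorem5
  (I : finType) (a : I -> I -> int) (ha : cartan a)
  (w0 : {ffun I -> int} -> {ffun I -> int}) (nu : nat)
  (hw0 : longest a w0 nu)
  (k : closedFieldType) (hk : [pchar k] =i pred0)
  (G : pinned_group k a)
  (phiZ : UK a nu w0 tropZ -> UK a nu w0 tropZ)
  (hphi : is_phi G phiZ)
  (p : I -> int) :
  (exists x, B_Np phiZ p x) -> forall i, 0 <= p i.
Proof.
case=> -[A A'] [[AA' [r Ar r0]] [[C C'] [_ [r' Cr' r'0]] [EA EA']]] i.
have {}AA' : phiZ A = A' := AA'.
case: hphi => E hE hZ.
have [[w m] [/= ww rm m0 [z ez]]] := nonneg_representative ha hw0 i (UK_word Ar) r0.
have Am : A (w, m) := UK_equiv Ar rm.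
pose e o : int := nqeval (tnth m) (E w w o).
have e_ge o : - p (tnth w o) <= e o.
  have h1 : A' (w, [tuple nqeval (tnth m) (E w w o) | o < nu]).
    by rewrite -AA'; apply: hZ.
  have h2 : A' (shift (fun j => - p j) r') by rewrite EA'; exists r'.
  have := pt_equiv_shift p (UK_related h1 h2); rewrite shiftVK => /pt_equiv_nonneg [_ h].
  have := h r'0 o; rewrite tnth_shift tnth_mktuple -/(e o) => h'.
  by rewrite -subr_ge0 opprK.
(* The constants in [nqeval_growth] count monomials: they are independent of [N]. *)
pose c o := size (terms (tnth m) (nq_num (E w w o))).
have bound (N : nat) : (0 < N)%N -> 1 <= (\sum_o c o)%N%:R * (N%:R : rat) ^ p i.
  move=> N0; have [phi0 hphi0 hE0] := hE Qpos _ (pr_embedP hk).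
  pose v := [tuple powN N0 (tnth m o) | o < nu] : nu.-tuple Qpos.
  have [AN hAN] := @UK_exists _ a w0 nu Qpos (w, v) ww.
  have [o prod1] := inverse_coordinate ha hw0 hk ez hphi0 hAN (hE0 w w v AN ww ww hAN).
  have N1 : 1 <= N%:R :> rat by rewrite ler1n.
  have mo : val (tnth v o : posrat) <= 1 :> rat.
    rewrite tnth_mktuple /=; have -> : 1 = (N%:R : rat) ^ (- 0) by [].
    exact: (powN_mono N0 (m0 o)).
  rewrite -[X in X <= _]prod1; apply: le_trans (ler_pM _ _ mo (lexx _)) _.
  - exact/ltW/(valP (tnth v o : posrat)).
  - by apply: sumr_ge0 => o' _; apply/ltW/(valP (tnth _ o' : posrat)).
  rewrite mul1r.
  apply: (@le_trans _ _ (\sum_(o' | tnth w o' == i) (c o')%:R * (N%:R : rat) ^ p i)); last first.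
    rewrite natr_sum mulr_suml [X in _ <= X](bigID (fun o' => tnth w o' == i)) /= lerDl.
    by apply: sumr_ge0 => o' _; rewrite mulr_ge0 ?ler0n // exprz_ge0 // ler0n.
  apply: ler_sum => o' /eqP wo'; rewrite tnth_mktuple.
  have -> : nqeval (tnth v) (E w w o') = nqeval (powN N0 \o tnth m) (E w w o').
    by apply: nqeval_ext => l; rewrite tnth_mktuple.
  apply: le_trans (nqeval_growth N0 (tnth m) (E w w o')) _.
  apply: ler_wpM2l; first exact: ler0n.
  by have := powN_mono N0 (e_ge o'); rewrite wo' opprK.
rewrite leNgt; apply/negP => p0.
(* Any [N] above the sum of the constants contradicts a negative [p i]. *)
pose N := (\sum_o c o)%N.+2.
have N0 : (0 < N)%N by [].
have := bound N N0; apply/negP; rewrite -ltNge.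
have p1 : 1 <= - p i by lia.
apply: le_lt_trans (ler_wpM2l (ler0n _ _) (_ : _ <= (N%:R : rat) ^ (- 1))) _.
  by have := powN_mono N0 p1; rewrite opprK.
by rewrite -[_ ^ _]/(N%:R^-1) ltr_pdivrMr ?ltr0n // mul1r ltr_nat /N ltnS leqnSn.
Qed.
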